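(* (i) For every positive integer $m\ge 3$, $\max\{\gamma(K):K\in\mathcal{P}(m,3)\}=2m-1$. (ii) For every integer $m\ge3$ and every $K\in\mathcal{P}(m,3)$, $K$ is exp-maximal if and only if there exists a $K$-primitive matrix $A$ such that the digraph $(\mathcal{E},\mathcal{P}(A,K))$ is isomorphic to $F_1$. (iii) Let $m\ge 3$ be a positive integer. For any $\theta\in(\frac{2\pi}{m},\frac{2\pi}{m-1})$, let $r_\theta$ denote the unique positive real root of the polynomial $$g_\theta(t)=\frac{\sin(m-1)\theta}{\sin\theta}\,t^m-\frac{\sin m\theta}{\sin\theta}\,t^{m-1}+1 .$$ Let $K_\theta$ be the polyhedral cone in $\mathbb{R}^3$ generated by the vectors $$x_j(\theta)=\begin{bmatrix} r_\theta^{j-1}\cos(j-1)\theta\\ r_\theta^{j-1}\sin(j-1)\theta\\ 1\end{bmatrix},\quad j=1,\ldots,m,$$ and let $A_\theta=r_\theta\begin{bmatrix}\cos\theta&-\sin\theta\\ \sin\theta&\cos\theta\end{bmatrix}\oplus[1]$. Then $x_1(\theta),\ldots,x_m(\theta)$ are the extreme vectors of $K_\theta$ (up to positive multiples), $K_\theta$ is an exp-maximal polyhedral cone, and $A_\theta$ is an exp-maximal $K_\theta$-primitive matrix.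
   Context: A proper cone $K$ in $\mathbb{R}^n$ is a closed convex cone that is pointed ($K\cap(-K)=\{0\}$) and has nonempty interior. A face of $K$ is a subcone $F\subseteq K$ such that $y\in F$ whenever $x\in F$ and $y,x-y\in K$. For $x\in K$, $\Phi(x)$ is the smallest face of $K$ containing $x$. A nonzero $x\in K$ is an extreme vector if $\Phi(x)=\{\lambda x:\lambda\ge0\}$, which is then an extreme ray. A polyhedral cone is a proper cone with finitely many extreme rays; $\mathcal{P}(m,n)$ is the set of $n$-dimensional polyhedral cones with exactly $m$ extreme rays. $\pi(K)$ is the set of real matrices $A$ with $AK\subseteq K$. $A\in\pi(K)$ is $K$-primitive if $A^p(K\setminus\{0\})\subseteq\operatorname{int}K$ for some positive integer $p$; the least such $p$ is the exponent $\gamma(A)$. For polyhedral $K$, $\gamma(K)=\max\{\gamma(A):A\text{ is }K\text{-primitive}\}$. A $K$-primitive matrix $A$ is exp-maximal if $\gamma(A)=\gamma(K)$. A cone $K_0\in\mathcal{P}(m,n)$ is exp-maximal if $\gamma(K_0)=\max\{\gamma(K):K\in\mathcal{P}(m,n)\}$. For $A\in\pi(K)$, $(\mathcal{E},\mathcal{P}(A,K))$ is the digraph whose vertices are the extreme rays of $K$, with an arc $(\Phi(x),\Phi(y))$ whenever $\Phi(y)\subseteq\Phi(Ax)$. $F_1$ is the digraph on vertices $x_1,\ldots,x_m$ with arcs $x_i\to x_{i+1}$ ($1\le i\le m-1$), $x_m\to x_1$ and $x_m\to x_2$. For $\theta$ in the given interval, $g_\theta$ does have a unique positive real root. *)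

(* Defs.v *)
From HB Require Import structures.
From mathcomp Require Import all_boot all_order all_algebra.
From mathcomp Require Import all_classical all_reals all_analysis.
Set Implicit Arguments.
Unset Strict Implicit.
Unset Printing Implicit Defensive.
Import Order.TTheory GRing.Theory Num.Theory.
Import numFieldNormedType.Exports.
Local Open Scope classical_set_scope.
Local Open Scope ring_scope.

Definition is_max (S : set nat) (p : nat) : Prop := S p /\ ubound S p.

Section Cones.
Context {R : realType} {n : nat}.
Implicit Types (K F : set 'cV[R]_n) (x y : 'cV[R]_n) (A : 'M[R]_n).

Definition convex_cone K : Prop :=
  [/\ K 0,
      forall x y, K x -> K y -> K (x + y)
    & forall (c : R) x, 0 <= c -> K x -> K (c *: x)].

Definition proper_cone K : Prop :=
  [/\ convex_cone K, closed K, K `&` [set - x | x in K] = [set 0] & K° !=set0].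

Definition face K F : Prop :=
  [/\ F `<=` K, convex_cone F
    & forall x y, F x -> K y -> K (x - y) -> F y].

Definition Phi K x : set 'cV[R]_n := smallest (face K) [set x].

Definition extreme_vector K x : Prop :=
  [/\ K x, x != 0 & Phi K x = [set c *: x | c in [set c : R | 0 <= c]]].

Definition extreme_rays K : set (set 'cV[R]_n) :=
  [set Phi K x | x in extreme_vector K].

(* The set P(m, n); polyhedrality is implied by the finite number of rays. *)
Definition polycone (m : nat) K : Prop :=
  proper_cone K /\ (extreme_rays K #= `I_m)%card.

(* The set pi(K). *)
Definition cone_preserving K A : Prop := forall x, K x -> K (A *m x).

Definition power_positive K A (p : nat) : Prop :=
  forall x, K x -> x != 0 -> K° (A ^+ p *m x).

Definition primitive K A : Prop :=
  cone_preserving K A /\ exists2 p, (0 < p)%N & power_positive K A p.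

(* gamma(A) = p *)
Definition exponent K A (p : nat) : Prop :=
  [/\ (0 < p)%N, power_positive K A p
    & forall q, (0 < q)%N -> power_positive K A q -> (p <= q)%N].

(* gamma(K) = p *)
Definition cone_exponent K (p : nat) : Prop :=
  is_max [set q | exists2 A, primitive K A & exponent K A q] p.

Definition exp_maximal_matrix K A : Prop :=
  primitive K A /\ exists2 p, exponent K A p & cone_exponent K p.

(* Arcs of the digraph (E, P(A, K)). *)
Definition ray_arc K A (E F : set 'cV[R]_n) : Prop :=
  exists x y, [/\ extreme_vector K x, extreme_vector K y,
    E = Phi K x, F = Phi K y & Phi K y `<=` Phi K (A *m x)].

Definition generated_cone (m : nat) (v : 'I_m -> 'cV[R]_n) : set 'cV[R]_n :=
  [set x | exists2 c : 'I_m -> R,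
     forall i, 0 <= c i & x = \sum_(i < m) c i *: v i].

End Cones.

(* max {gamma(K) : K in P(m, n)} = p; since cone_exponent is a relation, the
   first conjunct says that gamma(K) is defined for every K in P(m, n). *)
Definition max_cone_exponent (R : realType) (m n p : nat) : Prop :=
  (forall K : set 'cV[R]_n, polycone m K -> exists q, cone_exponent K q) /\
  is_max [set q | exists2 K : set 'cV[R]_n, polycone m K & cone_exponent K q] p.

Definition exp_maximal_cone (R : realType) (m n : nat) (K : set 'cV[R]_n) : Prop :=
  polycone m K /\ exists2 p, cone_exponent K p & max_cone_exponent R m n p.

Definition digraph_iso (T U : Type) (V : set T) (e : T -> T -> Prop)
    (W : set U) (f : U -> U -> Prop) : Prop :=
  exists2 phi : T -> U, set_bij V W phi
    & forall x y, V x -> V y -> (e x y <-> f (phi x) (phi y)).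

(* The digraph F_1, with vertex x_(i+1) represented by i : 'I_m. *)
Definition F1 (m : nat) : rel 'I_m := fun i j =>
  (j == i.+1 :> nat) || ((i.+1 == m) && ((j == 0 :> nat) || (j == 1 :> nat))).

Section Family.
Context {R : realType}.

Definition g_poly (m : nat) (theta : R) : {poly R} :=
  (sin (m.-1%:R * theta) / sin theta) *: 'X^m
  - (sin (m%:R * theta) / sin theta) *: 'X^(m.-1) + 1.

(* x_(j+1)(theta), for r = r_theta. *)
Definition gen_vector (theta r : R) (j : nat) : 'cV[R]_3 :=
  \col_(i < 3) [:: r ^+ j * cos (j%:R * theta);
                   r ^+ j * sin (j%:R * theta);
                   1]`_i.

Definition K_theta (m : nat) (theta r : R) : set 'cV[R]_3 :=
  generated_cone (fun j : 'I_m => gen_vector theta r j).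

Definition rotation (theta : R) : 'M[R]_2 :=
  \matrix_(i < 2, j < 2)
    (nth [::] [:: [:: cos theta; - sin theta];
                  [:: sin theta;   cos theta]] i)`_j.

Definition A_theta (theta r : R) : 'M[R]_3 :=
  block_mx (r *: rotation theta) 0 0 (1%:M : 'M[R]_1).

End Family.

(* Main.v *)
Require Import Defs.
From HB Require Import structures.
From mathcomp Require Import all_boot all_order all_algebra.
From mathcomp Require Import all_classical all_reals all_analysis.
From mathcomp Require Import zify ring lra.
Set Implicit Arguments.
Unset Strict Implicit.
Unset Printing Implicit Defensive.
Import Order.TTheory GRing.Theory Num.Theory.
Import numFieldNormedType.Exports.
Local Open Scope classical_set_scope.
Local Open Scope ring_scope.

(** Say that [x] dominates [u] if [u] lies in the face generated by [x]. If [x]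
    lies on a circuit of length [s] of the digraph, then [A^s x] dominates [x]; the
    faces of [x], [A^s x], [A^(2s) x] grow strictly until they become [K], so in
    dimension 3 the vector [A^(2s) x] is interior. A walk of length [t] to such a
    circuit makes [A^(t+2s)] of its origin interior, and one may take [t + s <= m]
    with [s <= m-1], because a single circuit of length [m] would let [A] permute
    the rays. This gives the bound [2m-1], and equality forces the digraph [F_1].

    Conversely, for [F_1] the vector [A^(2m-2) x_1] lies in the cone of
    [x_(m-1), x_m], which is an edge of [K]: [A] carries the supporting plane of
    the edge [x_k, x_(k+1)] to that of [x_(k+1), x_(k+2)].

    The points of [K_theta] lie on a logarithmic spiral and [r_theta] is chosen so
    that [A x_m] falls on the segment [x_1 x_2]. Convex position follows from two
    telescoping sums of terms proportional to [r^l sin(l theta)], which are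
    unimodal in [l] and are controlled at both ends. *)

(** * Walks and the extremal digraph *)

(** Faces are handled through the preorder [dom] and interior points through [order_unit], so that
    linear algebra decides both: [x] is interior as soon as it dominates three independent members
    of [K]. In the digraph, following one chosen out-neighbour from each vertex meets [t + s]
    distinct vertices before closing a circuit of length [s]. When [t + 2 s] cannot drop below
    [2 m - 1], these are all the vertices and no arc can be a shortcut. Some vertex must branch,
    since otherwise [A] would permute rays, and only [x_m] has room for it, towards [x_1] and [x_2].
    The obstacle in the converse is that the digraph does not record how the rays lie around the
    cone: [F_1] does not say that [x_k] and [x_(k+1)] are adjacent. The one edge visible in it is
    [x_1 x_2], because [A x_m] dominates these two rays only; hence the need to propagate
    adjacency. *)

Definition walk {T : eqType} (e : rel T) (k : nat) (x y : T) : Prop :=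
  exists p, [/\ path e x p, size p = k & last x p = y].

Lemma walk0 (T : eqType) (e : rel T) (x : T) : walk e 0 x x.
Proof. by exists [::]. Qed.

Lemma walk1 (T : eqType) (e : rel T) (x y : T) : e x y -> walk e 1 x y.
Proof. by move=> exy; exists [:: y]; rewrite /= exy. Qed.

Lemma walk_trans (T : eqType) (e : rel T) (k l : nat) (x y z : T) :
  walk e k x y -> walk e l y z -> walk e (k + l) x z.
Proof.
move=> [p [xp <- <-]] [q [yq <- <-]]; exists (p ++ q).
by rewrite cat_path xp yq size_cat last_cat.
Qed.

Lemma walk_iter (T : eqType) (e : rel T) (f : T -> T) (y : T) (i j : nat) :
  (forall x, e x (f x)) -> (i <= j)%N ->
  walk e (j - i) (iter i f y) (iter j f y).
Proof.
move=> ef; elim: j => [|j IH]; first by rewrite leqn0 => /eqP ->; apply: walk0.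
rewrite leq_eqVlt => /orP[/eqP ->|]; first by rewrite subnn; apply: walk0.
rewrite ltnS => ij; rewrite subSn // -addn1.
by apply: walk_trans (IH ij) _; apply: walk1; rewrite iterS.
Qed.

(* Extremal case of the Wielandt-type bound: [t + 2 s] bounds the exponent when
   [y] reaches in [t] steps a circuit of length [s]. *)
Lemma wielandt_digraph (m : nat) (e : rel 'I_m) (y : 'I_m) : (2 < m)%N ->
  (forall x, exists z, e x z) ->
  (forall S : {set 'I_m}, S != finset.set0 ->
     ~ (forall x, x \in S -> exists2 z, z \in S & forall w, e x w = (w == z))) ->
  (forall t s x, (0 < s)%N -> walk e t y x -> walk e s x x ->
     (2 * m - 1 <= t + 2 * s)%N) ->
  exists sg : 'I_m -> 'I_m,
    [/\ bijective sg, forall i : 'I_m, i = 0 :> nat -> sg i = y &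
      forall i j, e (sg i) (sg j) = F1 i j].
Proof.
move=> m2 /choice [f ef] branch H.
pose v i := iter i f y.
have W i j : (i <= j)%N -> walk e (j - i) (v i) (v j) by apply: walk_iter.
have km : (order f y <= m)%N by rewrite -[leqRHS]card_ord max_card.
have /trajectP[t tk vk] := looping_order f y.
have := W 0%N t isT; rewrite subn0 => W0t.
have Wtt : walk e (order f y - t) (v t) (v t).
  by rewrite -[X in walk _ _ _ X]vk; apply: W; apply: ltnW.
have Ht := H _ _ _ _ W0t Wtt.
(* [Ht] reads [2 * m - 1 <= t + 2 * (order f y - t)] and [order f y <= m]: the iterates of [y] visit
   every vertex, and the last one returns to [v 0] or [v 1]. *)
have [ek t1] : order f y = m /\ (t <= 1)%N by lia.
rewrite ek in tk vk.
have vinj i j : (i < m)%N -> (j < m)%N -> v i = v j -> i = j.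
  move=> im jm eij; have := orbit_uniq f y; rewrite /orbit ek => un.
  by apply/eqP; rewrite -(nth_uniq y _ _ un) ?size_traject // !nth_traject //; apply/eqP.
pose sg (i : 'I_m) := v i.
have sgi : injective sg by move=> i j /vinj eij; apply/val_inj/eij.
have sgb : bijective sg by apply: injF_bij.
have sgs x : exists2 i : nat, (i < m)%N & x = v i.
  by have [g _ sgK] := sgb; exists (g x) => //; rewrite -[LHS]sgK.
(* [v j] is reached in [j] steps and the arc closes a circuit of length [i - j + 1], so
   [2 * m - 1 <= 2 * i - j + 2]. *)
have back i j : (j <= i)%N -> (i < m)%N -> e (v i) (v j) ->
    i = m.-1 /\ (j <= 1)%N.
  move=> ji im eij; have W0j := W 0%N j isT; rewrite subn0 in W0j.
  by have := H _ _ _ _ W0j (walk_trans (W _ _ ji) (walk1 eij)); lia.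
have elast : e (v m.-1) (v t).
  by rewrite [v t](esym vk); have := ef (v m.-1); rewrite -iterS prednK //; lia.
(* A forward jump gives a circuit through [v t] of length at most [m - t - 1], too short for [H],
   unless it starts before [v t]. *)
have skip i j : (i.+1 < j)%N -> (j < m)%N -> e (v i) (v j) -> i = 0%N /\ t = 1%N.
  move=> ij jm eij.
  have Wjt : walk e (m - j) (v j) (v t).
    have -> : (m - j = m.-1 - j + 1)%N by lia.
    by apply: walk_trans (W _ _ _) (walk1 elast); lia.
  have [ti|it] := leqP t i.
    have Wc : walk e (i - t + 1 + (m - j)) (v t) (v t).
      apply: walk_trans Wjt.
      by apply: walk_trans (W _ _ ti) (walk1 eij).
    have W0 := W 0%N t isT; rewrite subn0 in W0.
    by have := H _ _ _ _ W0 Wc; lia.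
  by lia.
have e0 : e (v m.-1) (v 0%N).
  apply: contrapT => ne0.
  have t1' : t = 1%N by case: (t) t1 elast => [|[|k]].
  rewrite t1' in elast.
  (* With no arc back to [y], the other vertices would form one circuit without branching. *)
  pose S := [set x | x != y]%SET.
  apply: (branch S) => [|x].
    apply/set0Pn; exists (v 1%N); rewrite inE; apply/eqP => v1.
    by have := vinj 1%N 0%N; rewrite v1 => /(_ _ _ erefl); lia.
  have [i im ->{x}] := sgs x; rewrite inE => iy.
  have i0 : (0 < i)%N by case: i im iy => // _; rewrite eqxx.
  have nex j : (0 < j < m)%N -> v j \in S.
    case/andP => j0 jm; rewrite inE; apply/eqP => vj.
    by have := vinj j 0%N; rewrite vj => /(_ jm _ erefl); lia.
  have [im1|im1] := eqVneq i m.-1.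
    exists (v 1%N); first by apply: nex; lia.
    move=> w; have [j jm ->] := sgs w; apply/idP/eqP => [|->]; last by rewrite im1.
    move=> eij; have [|] := leqP j i => ij; last by lia.
    have [_ j1] := back _ _ ij im eij.
    have [j0|->//] : j = 0%N \/ j = 1%N by lia.
      by case: ne0; rewrite -j0 -im1.
  exists (v i.+1); first by apply: nex; lia.
  move=> w; have [j jm ->] := sgs w; apply/idP/eqP => [|->]; last exact: ef.
  move=> eij; have [|] := leqP j i => ij; first by have := back _ _ ij im eij; lia.
  have [<-//|ne] := eqVneq i.+1 j.
  by have := @skip i j; lia.
(* Now a jump from [v 0] to [v j] lies on a circuit through [y] itself, of length
   [m - j + 1 <= m - 1]; [H] with the empty initial walk excludes it. *)
have skip0 i j : (i.+1 < j)%N -> (j < m)%N -> ~ e (v i) (v j).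
  move=> ij jm eij; have [i0 _] := skip _ _ ij jm eij; rewrite {}i0 in eij ij.
  have Wj0 : walk e (m.-1 - j + 1) (v j) (v 0%N).
    by apply: walk_trans (W _ _ _) (walk1 e0); lia.
  by have := H _ _ _ _ (walk0 _ _) (walk_trans (walk1 eij) Wj0); lia.
have e1 : e (v m.-1) (v 1%N).
  apply: contrapT => ne1.
  apply: (branch finset.setT) => [|x _].
    by apply/set0Pn; exists y; rewrite inE.
  have [i im ->{x}] := sgs x.
  have [im1|im1] := eqVneq i m.-1.
    exists (v 0%N); first by rewrite inE.
    move=> w; have [j jm ->] := sgs w; apply/idP/eqP => [|->]; last by rewrite im1.
    move=> eij; have [|] := leqP j i => ij; last by lia.
    have [_ j1] := back _ _ ij im eij.
    have [->//|j0] : j = 0%N \/ j = 1%N by lia.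
    by case: ne1; rewrite -j0 -im1.
  exists (v i.+1); first by rewrite inE.
  move=> w; have [j jm ->] := sgs w; apply/idP/eqP => [|->]; last exact: ef.
  move=> eij; have [|] := leqP j i => ij; first by have := back _ _ ij im eij; lia.
  have [<-//|ne] := eqVneq i.+1 j.
  by have := @skip0 i j; lia.
exists sg; split=> // [i i0|i j]; first by rewrite /sg i0.
rewrite /F1 /sg; apply/idP/idP => [eij|].
  have [ji|ij] := leqP j i.
    by have [? ?] := back _ _ ji (ltn_ord i) eij; apply/orP; right; lia.
  have [<-|ne] := eqVneq i.+1 (j : nat); first by [].
  by case: (skip0 i j) => //; have := ltn_ord j; lia.
move=> /orP[/eqP ->|/andP[/eqP im]]; first exact: ef.
have -> : (i : nat) = m.-1 by lia.
by case/orP => /eqP ->.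
Qed.

(** * The order of a cone *)

Section ConeOrder.
Context {R : realType} {n : nat}.
Implicit Types (K : set 'cV[R]_n) (x y u w : 'cV[R]_n) (A : 'M[R]_n).

(** Unlike for [Phi K x], [u] may lie outside [K]; this lets [order_unit] quantify over the whole
    space. *)
Definition dom K x u : Prop := exists2 c : R, 0 <= c & K (c *: x - u).

Definition order_unit K x : Prop := K x /\ forall u, dom K x u.

Section Order.
Variable K : set 'cV[R]_n.
Hypothesis Kc : convex_cone K.

Lemma cone0 : K 0. Proof. by case: Kc. Qed.

Lemma coneD x y : K x -> K y -> K (x + y). Proof. by case: Kc => _ + _; apply. Qed.

Lemma coneZ (c : R) x : 0 <= c -> K x -> K (c *: x).
Proof. by case: Kc => _ _; apply. Qed.

Lemma dom_refl x : dom K x x.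
Proof. by exists 1 => //; rewrite scale1r subrr; apply: cone0. Qed.

Lemma dom_trans y x u : dom K x y -> dom K y u -> dom K x u.
Proof.
move=> [c c0 Kc1] [d d0 Kd]; exists (d * c); first exact: mulr_ge0.
have -> : (d * c) *: x - u = d *: (c *: x - y) + (d *: y - u).
  by rewrite scalerBr scalerA addrA subrK.
by apply: coneD => //; apply: coneZ.
Qed.

Lemma domD x u w : dom K x u -> dom K x w -> dom K x (u + w).
Proof.
move=> [c c0 Kcu] [d d0 Kd]; exists (c + d); first exact: addr_ge0.
by rewrite scalerDl opprD addrACA; apply: coneD.
Qed.

Lemma domZ_ge0 x u (a : R) : 0 <= a -> dom K x u -> dom K x (a *: u).
Proof.
move=> a0 [c c0 Kcu]; exists (a * c); first exact: mulr_ge0.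
by rewrite -scalerA -scalerBr; apply: coneZ.
Qed.

Lemma dom_opp x u : K u -> dom K x (- u).
Proof. by move=> Ku; exists 0 => //; rewrite scale0r opprK add0r. Qed.

(** A negative multiple of a member of [K] is dominated by every vector. Hence arbitrary linear
    combinations of dominated members of [K] are dominated, whatever their signs. *)
Lemma domZ x u (a : R) : K u -> dom K x u -> dom K x (a *: u).
Proof.
move=> Ku xu; have [a0|a0] := lerP 0 a; first exact: domZ_ge0.
rewrite -[a]opprK scaleNr; apply: dom_opp; apply: coneZ => //.
by rewrite oppr_ge0 ltW.
Qed.

Lemma dom_pscale x (a : R) : 0 < a -> dom K (a *: x) x.
Proof.
move=> a0; exists a^-1; first by rewrite invr_ge0 ltW.
by rewrite scalerA mulVf ?gt_eqF // scale1r subrr; apply: cone0.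
Qed.

Lemma dom_addl x y : K y -> dom K (x + y) x.
Proof. by move=> Ky; exists 1 => //; rewrite scale1r addrC addKr. Qed.

Lemma dom_addr x y : K x -> dom K (x + y) y.
Proof. by rewrite addrC; apply: dom_addl. Qed.

Lemma dom_mulmx A x u :
  cone_preserving K A -> dom K x u -> dom K (A *m x) (A *m u).
Proof.
by move=> KA [c c0 Ku]; exists c => //; rewrite scalemxAr -mulmxBr; apply: KA.
Qed.

Lemma order_unit_dom x y : K x -> dom K x y -> order_unit K y -> order_unit K x.
Proof. by move=> Kx xy [_ yu]; split=> // u; apply: dom_trans xy _. Qed.

Lemma Phi_dom x : K x -> Phi K x = [set u | K u /\ dom K x u].
Proof.
move=> Kx; apply/seteqP; split=> [|u [Ku [c c0 Kcu]] F [[_ Fc Ff] Fx]].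
  apply: smallest_sub; last by move=> _ ->; split=> //; apply: dom_refl.
  split=> [u []//||u w [Ku xu] Kw Kuw].
    split=> [|u w [Ku xu] [Kw xw]|c u c0 [Ku xu]].
    - split; first exact: cone0.
      by exists 0 => //; rewrite scale0r subrr; apply: cone0.
    - by split; [apply: coneD|apply: domD].
    - by split; [apply: coneZ|apply: domZ_ge0].
  split=> //; apply: dom_trans xu _.
  by exists 1; rewrite ?scale1r.
apply: (Ff (c *: x)) => //.
by case: Fc => _ _; apply=> //; apply: Fx.
Qed.

Lemma Phi_subset x y : K x -> K y -> (Phi K y `<=` Phi K x) <-> dom K x y.
Proof.
move=> Kx Ky; rewrite !Phi_dom //; split=> [/(_ y)|xy u [Ku yu]].
  by case=> //; split=> //; apply: dom_refl.
by split=> //; apply: dom_trans xy yu.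
Qed.

Lemma extreme_vectorP x : extreme_vector K x <->
  [/\ K x, x != 0 & forall u, K u -> dom K x u -> exists2 c, 0 <= c & u = c *: x].
Proof.
split=> [[Kx x0]|[Kx x0 ext]]; last first.
  split=> //; rewrite Phi_dom //; apply/seteqP; split=> [u [Ku xu]|_ [c /= c0 <-]].
    by have [c c0 ->] := ext u Ku xu; exists c.
  by split; [apply: coneZ|apply: domZ_ge0 => //; apply: dom_refl].
rewrite Phi_dom // => E; split=> // u Ku xu.
have : [set u | K u /\ dom K x u] u by [].
by rewrite E => -[c c0 <-]; exists c.
Qed.

End Order.

Lemma proper_convex K : proper_cone K -> convex_cone K. Proof. by case. Qed.

Lemma cone_pointed K x : proper_cone K -> K x -> K (- x) -> x = 0.
Proof.
move=> [_ _ KN _] Kx KNx; have : (K `&` [set - x | x in K]) x.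
  by split=> //; exists (- x) => //; rewrite opprK.
by rewrite KN.
Qed.

Lemma cone_dom0 K u : proper_cone K -> K u -> dom K 0 u -> u = 0.
Proof.
by move=> Kp Ku [c _]; rewrite scaler0 add0r; apply: cone_pointed.
Qed.

End ConeOrder.

(** * Closedness and interior in terms of the order *)

Section ConeTopology.
Context {R : realType} {n : nat}.
Implicit Types (K : set 'cV[R]_n.+1) (x y u w : 'cV[R]_n.+1).

Lemma cone_archimedean K x u : closed K ->
  (forall e : R, 0 < e -> K (x + e *: u)) -> K x.
Proof.
move=> Kcl H; apply: Kcl => B /nbhs_ballP[e /= e0 xB].
pose d := e / (2 * (1 + `|u|)).
have u1 : 0 < 1 + `|u| by rewrite ltr_pwDl.
have d0 : 0 < d by rewrite divr_gt0 ?mulr_gt0.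
exists (x + d *: u); split; first exact: H.
apply: xB; rewrite -ball_normE /= opprD addNKr normrN normrZ gtr0_norm //.
rewrite /d mulrAC ltr_pdivrMr ?mulr_gt0 // ltr_pM2l //.
by have := normr_ge0 u; lra.
Qed.

(** From an interior point one can step slightly against any [u]. Conversely an order unit dominates
    some interior point [z], so a multiple of it is [z] plus a member of [K], and a ball around [z]
    may be translated. *)
Lemma interior_order_unit K x : proper_cone K -> K° x <-> order_unit K x.
Proof.
move=> Kp; have Kc := proper_convex Kp; split=> [Kx|[Kx xu]].
  split=> [|u]; first exact: interior_subset.
  have /nbhs_ballP[e /= e0 xB] := Kx.
  have u1 : 0 < 1 + `|u| by rewrite ltr_pwDl.
  pose d := e / (2 * (1 + `|u|)).
  have d0 : 0 < d by rewrite divr_gt0 ?mulr_gt0.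
  exists d^-1; first by rewrite invr_ge0 ltW.

  have -> : d^-1 *: x - u = d^-1 *: (x - d *: u).
    by rewrite scalerBr scalerA mulVf ?gt_eqF // scale1r.
  apply: coneZ => //; first by rewrite invr_ge0 ltW.
  apply: xB; rewrite -ball_normE /= opprB addrC subrK normrZ gtr0_norm //.
  rewrite /d mulrAC ltr_pdivrMr ?mulr_gt0 // ltr_pM2l //.
  by have := normr_ge0 u; lra.
have [_ _ _ [z Kz]] := Kp.
have [c c0 Kcz] := xu z.
pose d := c + 1.
have d0 : 0 < d by rewrite ltr_wpDl.
have Kdz : K (d *: x - z).
  by rewrite /d scalerDl scale1r addrAC; apply: coneD.
have /nbhs_ballP[e /= e0 zB] := Kz.
apply/nbhs_ballP; exists (e / d) => /=; first exact: divr_gt0.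
move=> w; rewrite -ball_normE /= => xw.
have -> : w = d^-1 *: ((d *: x - z) + (z + d *: (w - x))).
  by rewrite addrA subrK -scalerDr addrC subrK scalerA mulVf ?gt_eqF // scale1r.
apply: coneZ => //; first by rewrite invr_ge0 ltW.
apply: coneD => //; apply: zB; rewrite -ball_normE /= opprD addNKr normrN normrZ.
by rewrite gtr0_norm // mulrC -ltr_pdivlMr // distrC.
Qed.

Lemma exists_order_unit K : proper_cone K -> exists x, order_unit K x.
Proof.
by move=> Kp; have [_ _ _ [z Kz]] := Kp; exists z; apply/interior_order_unit.
Qed.

(** [t] is the supremum of the admissible multiples: it is finite because [K] is pointed and
    attained because [K] is closed. This is the tool for descending to a strictly smaller face. *)
Lemma subtract_max K x y : proper_cone K -> K x -> K y -> y != 0 ->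
  exists t : R, [/\ 0 <= t, K (x - t *: y) & ~ dom K (x - t *: y) y].
Proof.
move=> Kp Kx Ky y0; have Kc := proper_convex Kp.
have Kcl : closed K by case: Kp.
pose S := [set t : R | 0 <= t /\ K (x - t *: y)].
have S0 : S 0 by split=> //; rewrite scale0r subr0.
have Sub : has_ubound S.
  apply: contrapT => nub; case/eqP: y0.
  apply: (cone_pointed Kp) => //; apply: (@cone_archimedean _ _ x) => // e e0.
  have [t [[t0 Kt] et]] : exists t, S t /\ e^-1 < t.
    apply: contrapT => H; apply: nub; exists e^-1 => t St.
    by rewrite leNgt; apply/negP => et; apply: H; exists t.
  have t0' : 0 < t by apply: lt_trans et; rewrite invr_gt0.
  have -> : - y + e *: x = t^-1 *: (x - t *: y) + (e - t^-1) *: x.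
    rewrite scalerBr scalerA mulVf ?gt_eqF // scale1r scalerBl.
    by apply/matrixP => i j; rewrite !mxE; ring.
  apply: coneD => //; apply: coneZ => //; first by rewrite invr_ge0.
  by rewrite subr_ge0 -[e]invrK lef_pV2 ?posrE ?invr_gt0 // ltW.
have hS : has_sup S by split=> //; exists 0.
pose t := sup S.
have t0 : 0 <= t by apply: ub_le_sup.
have Kt : K (x - t *: y).
  apply: (@cone_archimedean _ _ y) => // e e0.
  have [s [s0 Ks] st] := sup_adherent e0 hS.
  have -> : x - t *: y + e *: y = x - s *: y + (s - (t - e)) *: y.
    by apply/matrixP => i j; rewrite !mxE; ring.
  by apply: coneD => //; apply: coneZ => //; rewrite subr_ge0 ltW.
exists t; split=> // -[c c0].
have c1 : 0 < c + 1 by rewrite ltr_wpDl.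
move=> Kcy; have : S (t + (c + 1)^-1).
  split; first by rewrite addr_ge0 // invr_ge0 ltW.
  have -> : x - (t + (c + 1)^-1) *: y = (c + 1)^-1 *: ((c *: (x - t *: y) - y) + (x - t *: y)).
    apply/matrixP => i j; rewrite !mxE; field; exact: lt0r_neq0.
  by apply: coneZ; rewrite ?invr_ge0 ?ltW //; apply: coneD.
move/(ub_le_sup Sub); apply/negP; rewrite -ltNge ltrDl invr_gt0 //.
Qed.

End ConeTopology.

(** * Determinants and linear dependence in dimension three *)

Section Dim3.
Context {R : realType}.
Implicit Types (K : set 'cV[R]_3) (x y z u w : 'cV[R]_3) (A : 'M[R]_3).

Lemma ord3_ind (P : 'I_3 -> Prop) : P 0 -> P 1 -> P ord_max -> forall i, P i.
Proof.
move=> P0 P1 P2 [[|[|[|//]]] i3]; [move: P0|move: P1|move: P2];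
  by congr P; apply: val_inj.
Qed.

Definition det3 x y z : R :=
  let a := x 0 0 in let b := x 1 0 in let c := x ord_max 0 in
  let d := y 0 0 in let e := y 1 0 in let f := y ord_max 0 in
  let g := z 0 0 in let h := z 1 0 in let i := z ord_max 0 in
  a * (e * i - f * h) - b * (d * i - f * g) + c * (d * h - e * g).

Lemma cramer3 x y z w :
  det3 x y z *: w = det3 w y z *: x + det3 x w z *: y + det3 x y w *: z.
Proof.
apply/matrixP => i j; rewrite [j]ord1 !mxE /det3.
by elim/ord3_ind: i; ring.
Qed.

Lemma det3_rot x y z : det3 x y z = det3 y z x. Proof. by rewrite /det3; ring. Qed.

Lemma det3_swap x y z : det3 y x z = - det3 x y z. Proof. by rewrite /det3; ring. Qed.

Lemma det3D x y z w : det3 x y (z + w) = det3 x y z + det3 x y w.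
Proof. by rewrite /det3 !mxE; ring. Qed.

Lemma det3Z x y z (c : R) : det3 x y (c *: z) = c * det3 x y z.
Proof. by rewrite /det3 !mxE; ring. Qed.

Lemma det3xx x z : det3 x x z = 0. Proof. by rewrite /det3; ring. Qed.

Lemma det3xyx x y : det3 x y x = 0. Proof. by rewrite /det3; ring. Qed.

Lemma det3xyy x y : det3 x y y = 0. Proof. by rewrite /det3; ring. Qed.

Lemma det3_mulmx A x y z :
  det3 (A *m x) (A *m y) (A *m z) =
  det3 (col 0 A) (col 1 A) (col ord_max A) * det3 x y z.
Proof.
have E v (i : 'I_3) : (A *m v) i 0 = A i 0 * v 0 0 + A i 1 * v 1 0 + A i ord_max * v ord_max 0.
  rewrite mxE !big_ord_recl big_ord0 addr0 addrA.
  by congr (_ * _ + _ * _ + _ * _); congr (_ _ _); apply: val_inj.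
by rewrite /det3 !E !mxE; ring.
Qed.

(** Cramer's rule with vanishing determinant is a relation whose coefficients depend on a free
    vector [w]. If they vanish for every [w], basis vectors show that all 2x2 minors of [x], [y] are
    zero, so these two are already dependent. *)
Lemma det3_eq0 x y z : det3 x y z = 0 ->
  exists a b c : R, (a, b, c) != (0, 0, 0) /\ a *: x + b *: y + c *: z = 0.
Proof.
move=> D0.
have [[w /eqP Dw]|H] := pselect (exists w, (det3 w y z, det3 x w z, det3 x y w) != (0,0,0)).
  exists (det3 w y z), (det3 x w z), (det3 x y w); split; first exact/eqP.
  by rewrite -cramer3 D0 scale0r.
have {}H w : det3 w y z = 0 /\ det3 x w z = 0 /\ det3 x y w = 0.
  by apply: contrapT => N; apply: H; exists w; apply/eqP => -[? ? ?]; apply: N.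
have [x0|x0] := eqVneq x 0.
  exists 1, 0, 0; rewrite x0 scaler0 !scale0r !addr0; split=> //.
  by apply/eqP => -[/eqP]; rewrite oner_eq0.
have [i xi] : exists i, x i 0 != 0.
  apply: contrapT => N; case/eqP: x0; apply/matrixP => i j; rewrite [j]ord1 !mxE.
  by apply: contrapT => xi; apply: N; exists i; apply/eqP.
exists (- y i 0), (x i 0), 0; split; first by apply/eqP => -[_ /eqP]; apply/negP.
have minor w : det3 x y w = 0 by case: (H w) => _ [].
have := (minor (delta_mx 0 0), minor (delta_mx 1 0), minor (delta_mx ord_max 0)).
rewrite /det3 !mxE /= => -[[m0 m1] m2].
apply/matrixP => j k; rewrite [k]ord1 !mxE {xi}.
by elim/ord3_ind: i; elim/ord3_ind: j; lra.
Qed.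

End Dim3.

(** * Faces and extreme rays of three-dimensional cones *)

Section Faces3.
Context {R : realType}.
Variable K : set 'cV[R]_3.
Hypothesis Kp : proper_cone K.
Implicit Types (x y z u w : 'cV[R]_3) (A : 'M[R]_3).
Let Kc : convex_cone K := proper_convex Kp.

Lemma det3_order_unit x u w z : K x -> K u -> K w -> K z ->
  dom K x u -> dom K x w -> dom K x z -> det3 u w z != 0 -> order_unit K x.
Proof.
move=> Kx Ku Kw Kz xu xw xz D0; split=> // t.
have -> : t = (det3 t w z / det3 u w z) *: u + (det3 u t z / det3 u w z) *: w +
              (det3 u w t / det3 u w z) *: z.
  rewrite ![_ / det3 u w z]mulrC -!scalerA -!scalerDr -cramer3.
  by rewrite scalerA mulVf // scale1r.
by apply: domD => //; [apply: domD => //|]; apply: domZ.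
Qed.

(** Strictness makes [x], [y], [z] independent: a relation involving [z] would put it in the span of
    [x], [y] and let [y] dominate it, and a relation between [x] and [y] would let [x] dominate
    [y]. *)
Lemma dom_chain3 x y z : K x -> K y -> K z -> x != 0 ->
  dom K y x -> dom K z y -> ~ dom K x y -> ~ dom K y z -> order_unit K z.
Proof.
move=> Kx Ky Kz x0 yx zy nxy nyz.
have zx := dom_trans Kc zy yx.
have [D0|] := eqVneq (det3 x y z) 0; last first.
  by apply: det3_order_unit => //; apply: dom_refl.
have [a [b [c [abc rel]]]] := det3_eq0 D0; exfalso.
have [c0|c0] := eqVneq c 0; last first.
  apply: nyz; have -> : z = (- (a / c)) *: x + (- (b / c)) *: y.
    apply: (scalerI c0); apply/eqP; rewrite -subr_eq0; apply/eqP.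
    transitivity (a *: x + b *: y + c *: z) => //.
    apply/matrixP => i j; rewrite !mxE; field; exact: c0.
  by apply: domD => //; apply: domZ => //; apply: dom_refl.
move: abc rel; rewrite c0 scale0r addr0 => abc rel.
have [b0|b0] := eqVneq b 0; last first.
  apply: nxy; have -> : y = (- (a / b)) *: x.
    apply: (scalerI b0); apply/eqP; rewrite -subr_eq0; apply/eqP.
    transitivity (a *: x + b *: y) => //.
    apply/matrixP => i j; rewrite !mxE; field; exact: b0.
  by apply: domZ => //; apply: dom_refl.
move: abc rel; rewrite b0 scale0r addr0 => abc /eqP.
rewrite scaler_eq0 (negPf x0) orbF => /eqP a0.
by rewrite a0 eqxx in abc.
Qed.

(** Well-founded induction on faces. A counterexample starts a strictly descending chain of four
    nonzero vectors; by [dom_chain3] the second is an order unit and so dominates the first. *)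
Lemma face_ind (P : 'cV[R]_3 -> Prop) : P 0 ->
  (forall x, K x -> x != 0 ->
     (forall y, K y -> dom K x y -> ~ dom K y x -> P y) -> P x) ->
  forall x, K x -> P x.
Proof.
move=> P0 step x0 Kx0; apply: contrapT => N0.
have next x : K x -> ~ P x -> exists y, [/\ K y, dom K x y, ~ dom K y x & ~ P y].
  move=> Kx Nx; apply: contrapT => H; apply: (Nx); apply: step => //.
    by apply/eqP => x0'; apply: Nx; rewrite x0'.
  by move=> y Ky xy nyx; apply: contrapT => Ny; apply: H; exists y.
have nz x : ~ P x -> x != 0 by move=> N; apply/eqP => x00; apply: N; rewrite x00.
have [x1 [Kx1 d1 n1 N1]] := next _ Kx0 N0.
have [x2 [Kx2 d2 n2 N2]] := next _ Kx1 N1.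
have [x3 [Kx3 d3 n3 N3]] := next _ Kx2 N2.
by have [_ /(_ x0)] := dom_chain3 Kx3 Kx2 Kx1 (nz _ N3) d3 d2 n3 n2.
Qed.

(** If [x] is not extreme, it dominates some [y] in [K] that is no multiple of it; subtracting as
    much of [y] as possible leaves a nonzero vector with a strictly smaller face. *)
Lemma dom_extreme x : K x -> x != 0 -> exists2 y, extreme_vector K y & dom K x y.
Proof.
move=> Kx; elim/face_ind: x / Kx; first by rewrite eqxx.
move=> x Kx x0 IH _.
have [ex|nex] := pselect (extreme_vector K x).
  by exists x => //; apply: dom_refl.
have [y [Ky xy nxy]] : exists y, [/\ K y, dom K x y & forall c, 0 <= c -> y <> c *: x].
  apply: contrapT => H; apply: nex; apply/extreme_vectorP => //; split=> // u Ku xu.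
  apply: contrapT => N; apply: H; exists u; split=> // c c0 uE.
  by apply: N; exists c.
have y0 : y != 0 by apply/eqP => y0; apply: (nxy 0) => //; rewrite scale0r.
have [t [t0 Kt nt]] := subtract_max Kp Kx Ky y0.
have xt : dom K x (x - t *: y).
  by exists 1 => //; rewrite scale1r opprB addrC subrK; apply: coneZ.
have xt0 : x - t *: y != 0.
  apply/eqP => /subr0_eq xE.
  have t0' : t != 0 by apply: contra_neq x0 => t0'; rewrite xE t0' scale0r.
  by apply: (nxy t^-1); rewrite ?invr_ge0 // xE scalerA mulVf // scale1r.
have [z ez tz] := IH _ Kt xt (fun tx => nt (dom_trans Kc tx xy)) xt0.
by exists z => //; apply: dom_trans xt tz.
Qed.

(** Numbered representatives replace the rays, which are sets in [extreme_rays] and [ray_arc];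
    [polycone_ray_system] and [digraph_iso_F1] translate back. *)
Definition ray_system (m : nat) (v : 'I_m -> 'cV[R]_3) : Prop :=
  [/\ forall i, extreme_vector K (v i),
      forall x, extreme_vector K x -> exists i (c : R), 0 < c /\ x = c *: v i
    & forall i j, dom K (v i) (v j) -> i = j].

Section RaySystem.
Variables (m : nat) (v : 'I_m -> 'cV[R]_3).
Hypothesis vr : ray_system v.

Lemma ray_in i : K (v i). Proof. by case: vr => /(_ i) []. Qed.

Lemma ray_neq0 i : v i != 0. Proof. by case: vr => /(_ i) []. Qed.

Lemma ray_dom i u : K u -> dom K (v i) u -> exists2 c, 0 <= c & u = c *: v i.
Proof. by case: vr => /(_ i)/(extreme_vectorP Kc)[_ _ + _ _]; apply. Qed.

Lemma ray_inj i j : dom K (v i) (v j) -> i = j. Proof. by case: vr => _ _; apply. Qed.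

Lemma dom_ray x : K x -> x != 0 -> exists i, dom K x (v i).
Proof.
move=> Kx x0; have [y ey xy] := dom_extreme Kx x0.
have [_ /(_ y ey)[i [c [c0 yE]]] _] := vr.
by exists i; apply: dom_trans xy _; rewrite // yE; apply: dom_pscale.
Qed.

(** Same descent as in [dom_extreme]: peel off the largest multiple of a dominated ray and continue
    in the smaller face. *)
Lemma ray_generate x : K x ->
  exists2 c : 'I_m -> R, forall i, 0 <= c i & x = \sum_i c i *: v i.
Proof.
move=> Kx; elim/face_ind: x / Kx.
  exists (fun=> 0) => //; rewrite big1 // => i _; exact: scale0r.
move=> x Kx x0 IH; have [i xi] := dom_ray Kx x0.
have [t [t0 Kt nt]] := subtract_max Kp Kx (ray_in i) (ray_neq0 i).
have xt : dom K x (x - t *: v i).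
  by exists 1 => //; rewrite scale1r opprB addrC subrK; apply: coneZ => //; apply: ray_in.
have [c c0 cE] := IH _ Kt xt (fun tx => nt (dom_trans Kc tx xi)).
exists (fun j => c j + (if j == i then t else 0)).
  by move=> j; case: ifP; rewrite ?addr0 // => _; apply: addr_ge0.
under eq_bigr do rewrite scalerDl.
rewrite big_split /= -cE (bigD1 i) //= eqxx big1 ?addr0 ?subrK // => j ji.
by rewrite (negPf ji) scale0r.
Qed.

Lemma generate_dom (c : 'I_m -> R) i : (forall j, 0 <= c j) -> 0 < c i ->
  dom K (\sum_j c j *: v j) (v i).
Proof.
move=> c0 ci; rewrite (bigD1 i) //=; apply: (@dom_trans _ _ K Kc (c i *: v i)).
  apply: dom_addl => //; elim/big_ind: _ => [|x y|j _]; first exact: cone0.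
    exact: coneD.
  by apply: coneZ => //; apply: ray_in.
exact: dom_pscale.
Qed.

Lemma generate_support (S : pred 'I_m) x : K x ->
  (forall j, dom K x (v j) -> S j) ->
  exists2 c : 'I_m -> R, forall i, 0 <= c i & x = \sum_(i | S i) c i *: v i.
Proof.
move=> Kx H; have [c c0 xE] := ray_generate Kx; exists c => //.
rewrite [LHS]xE [RHS]big_mkcond; apply: eq_bigr => i _; case: ifPn => // nSi.
have [->|ci] := eqVneq (c i) 0; first exact: scale0r.
case/negP: nSi; apply: H; rewrite xE; apply: generate_dom => //.
by rewrite lt_def ci c0.
Qed.

Lemma ray_nonneg_relation (a b c : R) i j k : i != j -> i != k ->
  0 <= b -> 0 <= c -> a *: v i + b *: v j + c *: v k = 0 -> (a, b, c) = (0, 0, 0).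
Proof.
move=> ij ik b0 c0; rewrite -addrA => rel.
have Kb := coneZ Kc b0 (ray_in j); have Kck := coneZ Kc c0 (ray_in k).
have Kbc := coneD Kc Kb Kck.
have scale0 (d : R) l : d *: v l = 0 -> d = 0.
  by move/eqP; rewrite scaler_eq0 (negPf (ray_neq0 l)) orbF => /eqP.
have neg l (d : R) : dom K (v i) (d *: v l) -> 0 <= d -> i != l -> d = 0.
  move=> il d0 ni; apply: contra_neq_eq ni => dn; apply: ray_inj.
  by apply: (dom_trans Kc il); apply: dom_pscale; rewrite // lt_def dn.
have vi : dom K (v i) (b *: v j + c *: v k).
  rewrite -(addKr (a *: v i) (_ + _)) rel addr0 -scaleNr.
  by apply: domZ => //; [apply: ray_in|apply: dom_refl].
have bz := neg _ _ (dom_trans Kc vi (dom_addl _ Kck)) b0 ij.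
have cz := neg _ _ (dom_trans Kc vi (dom_addr _ Kb)) c0 ik.
move: rel; rewrite bz cz !scale0r !addr0 => /scale0 ->.
by [].
Qed.

(** In a relation between three rays, two coefficients are nonnegative, possibly after a global
    change of sign. Then the third ray dominates those two terms, and extremality kills them. *)
Lemma rays_det3_neq0 i j k : i != j -> j != k -> i != k ->
  det3 (v i) (v j) (v k) != 0.
Proof.
move=> ij jk ik; apply/eqP => D0.
have [a [b [c [abc rel]]]] := det3_eq0 D0.
have relN : (- a) *: v i + (- b) *: v j + (- c) *: v k = 0.
  by rewrite !scaleNr -!opprD rel oppr0.
have rotr (x y z : 'cV[R]_3) : x + y + z = 0 -> y + z + x = 0.
  by rewrite -addrA addrC.
have ji : j != i by rewrite eq_sym.
have kj : k != j by rewrite eq_sym.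
have ki : k != i by rewrite eq_sym.
have [] : (a, b, c) = (0, 0, 0); last by move=> a0 b0 c0; rewrite a0 b0 c0 eqxx in abc.
have r1 := @ray_nonneg_relation _ _ _ _ _ _ ij ik.
have r2 := @ray_nonneg_relation _ _ _ _ _ _ jk ji.
have r3 := @ray_nonneg_relation _ _ _ _ _ _ ki kj.
have opp0 (x y z : R) : (- x, - y, - z) = (0, 0, 0) -> (x, y, z) = (0, 0, 0).
  by move=> -[/eqP + /eqP + /eqP]; rewrite !oppr_eq0 => /eqP -> /eqP -> /eqP ->.
have rot2 (x y z : R) : (y, z, x) = (0, 0, 0) -> (x, y, z) = (0, 0, 0).
  by move=> -[-> -> ->].
have n1 (x : R) : x <= 0 -> 0 <= - x by rewrite oppr_ge0.
have [a0|/ltW/n1 a0] := leP 0 a; have [b0|/ltW/n1 b0] := leP 0 b;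
  have [c0|/ltW/n1 c0] := leP 0 c.
- by apply: r1.
- by do 2!apply/rot2; apply: r3 => //; do 2!apply/rotr.
- by apply: rot2; apply: r2 => //; apply: rotr.
- by apply: opp0; apply: r1.
- by apply: r1.
- by apply: opp0; apply: rot2; apply: r2 => //; apply: rotr.
- by apply: opp0; do 2!apply/rot2; apply: r3 => //; do 2!apply/rotr.
- by apply: opp0; apply: r1.
Qed.

End RaySystem.
End Faces3.

(** * Exponents of primitive matrices *)

Section Exponent.
Context {R : realType}.
Variable K : set 'cV[R]_3.
Hypothesis Kp : proper_cone K.
Implicit Types (x y z u w : 'cV[R]_3) (A : 'M[R]_3).
Let Kc : convex_cone K := proper_convex Kp.

Lemma mulmx_expD A (p q : nat) x : A ^+ (p + q) *m x = A ^+ p *m (A ^+ q *m x).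
Proof. by rewrite exprD -mulmxE mulmxA. Qed.

Lemma mulmx_expS A (p : nat) x : A ^+ p.+1 *m x = A *m (A ^+ p *m x).
Proof. by rewrite exprS -mulmxE mulmxA. Qed.

Lemma mulmx_expSr A (p : nat) x : A ^+ p.+1 *m x = A ^+ p *m (A *m x).
Proof. by rewrite exprSr -mulmxE mulmxA. Qed.

Lemma cone_preserving_exp A (p : nat) : cone_preserving K A -> cone_preserving K (A ^+ p).
Proof.
move=> KA; elim: p => [|p IH] x Kx; first by rewrite expr0 mul1mx.
by rewrite mulmx_expSr; apply: IH; apply: KA.
Qed.

Lemma order_unit_neq0 x y : order_unit K x -> K y -> y != 0 -> x != 0.
Proof.
move=> [Kx xu] Ky; apply: contra_neq => x0; apply: (cone_dom0 Kp Ky).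
by rewrite -x0.
Qed.

Lemma power_positiveP A (p : nat) :
  power_positive K A p <-> forall x, K x -> x != 0 -> order_unit K (A ^+ p *m x).
Proof.
by split=> H x Kx x0; have := H x Kx x0; rewrite (interior_order_unit _ Kp).
Qed.

Lemma order_unit_mulmx A x y : cone_preserving K A ->
  K y -> order_unit K (A *m y) -> order_unit K x -> order_unit K (A *m x).
Proof.
move=> KA Ky Ayu [Kx xu]; apply: order_unit_dom Ayu => //; first exact: KA.
exact: dom_mulmx.
Qed.

Section Primitive.
Variable A : 'M[R]_3.
Hypothesis Apr : primitive K A.
Let KA : cone_preserving K A. Proof. by case: Apr. Qed.

Lemma primitive_neq0 x : K x -> x != 0 -> A *m x != 0.
Proof.
move=> Kx x0; have [_ [p p0 /power_positiveP Pp]] := Apr.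
have := order_unit_neq0 (Pp x Kx x0) Kx x0; apply: contra_neq => Ax0.
by rewrite -(prednK p0) mulmx_expSr Ax0 mulmx0.
Qed.

Lemma primitive_exp_neq0 (q : nat) x : K x -> x != 0 -> A ^+ q *m x != 0.
Proof.
move=> Kx x0; elim: q => [|q IH]; first by rewrite expr0 mul1mx.
rewrite mulmx_expS; apply: primitive_neq0 IH.
exact: cone_preserving_exp.
Qed.

Lemma power_positive_leq (p q : nat) :
  (p <= q)%N -> power_positive K A p -> power_positive K A q.
Proof.
move=> pq Pp x Kx x0; rewrite -(subnKC pq) mulmx_expD.
by apply: Pp; [apply: cone_preserving_exp|apply: primitive_exp_neq0].
Qed.

Lemma primitive_order_unit_leq (p q : nat) x : K x -> (p <= q)%N ->
  order_unit K (A ^+ p *m x) -> order_unit K (A ^+ q *m x).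
Proof.
move=> Kx pq; rewrite -(subnK pq); elim: (q - p)%N => // k IH u.
rewrite addSn mulmx_expS; have [_ [l l0 /power_positiveP Pl]] := Apr.
have [x00|x0] := eqVneq x 0.
  by move: (IH u); rewrite x00 !mulmx0.
apply: (@order_unit_mulmx _ _ (A ^+ l.-1 *m x)) (IH u) => //.
  exact: cone_preserving_exp.
have := Pl x Kx x0; rewrite -{1}(prednK l0) mulmx_expS.
exact.
Qed.

(** The face of [x] is stable under [A^s], and a high power of [A^s] sends [x] to the interior, so
    this face is all of [K]. *)
Lemma stable_order_unit (s : nat) x : (0 < s)%N -> K x -> x != 0 ->
  dom K x (A ^+ s *m x) -> order_unit K x.
Proof.
move=> s0 Kx x0 xs; have [_ [p p0 Pp]] := Apr.
have xsk k : dom K x (A ^+ (s * k) *m x).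
  elim: k => [|k IH]; first by rewrite muln0 expr0 mul1mx; apply: dom_refl.
  apply: (dom_trans Kc xs); rewrite mulnS mulmx_expD.
  by apply: dom_mulmx IH; apply: cone_preserving_exp.
apply: (order_unit_dom Kc Kx (xsk p)).
have /power_positiveP := power_positive_leq (leq_pmull p s0) Pp; exact.
Qed.

(* The faces of [x], [A^s x], [A^(2s) x] increase strictly until they become [K]. *)
Lemma circuit_order_unit (s : nat) x : (0 < s)%N -> K x -> x != 0 ->
  dom K (A ^+ s *m x) x -> order_unit K (A ^+ (2 * s) *m x).
Proof.
move=> s0 Kx x0 sx.
have KAs := cone_preserving_exp s KA.
have Ky := KAs _ Kx; have y0 := primitive_exp_neq0 s Kx x0.
have zy := dom_mulmx KAs sx.
rewrite mul2n -addnn mulmx_expD.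
have [xy|nxy] := pselect (dom K x (A ^+ s *m x)).
  have xu := stable_order_unit s0 Kx x0 xy.
  have yu := order_unit_dom Kc Ky sx xu.
  exact: (order_unit_dom Kc (KAs _ Ky) zy yu).
have [yz|nyz] := pselect (dom K (A ^+ s *m x) (A ^+ s *m (A ^+ s *m x))).
  have yu := stable_order_unit s0 Ky y0 yz.
  exact: (order_unit_dom Kc (KAs _ Ky) zy yu).
exact: (dom_chain3 Kp Kx Ky (KAs _ Ky) x0 sx zy nxy nyz).
Qed.

End Primitive.

Section Digraph.
Variables (m : nat) (v : 'I_m -> 'cV[R]_3) (A : 'M[R]_3).
Hypothesis vr : ray_system K v.
Let Kv i : K (v i) := ray_in vr i.

Lemma dom_walk : cone_preserving K A -> forall (k : nat) (i j : 'I_m),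
  walk (fun i j => `[< dom K (A *m v i) (v j) >]) k i j -> dom K (A ^+ k *m v i) (v j).
Proof.
move=> KA k i j [p [+ <- <-]]; elim: p i => [|l p IH] i /=.
  by rewrite expr0 mul1mx => _; apply: dom_refl.
move=> /andP[/asboolP il /IH lp]; rewrite mulmx_expSr.
apply: dom_trans lp => //; apply: dom_mulmx il.
exact: cone_preserving_exp.
Qed.

Lemma ray_order_unit_neq i : (1 < m)%N -> ~ order_unit K (v i).
Proof.
move=> m1 [_ iu].
have all j : j = i by apply/esym/(ray_inj vr)/iu.
have := all (Ordinal m1); rewrite -(all (Ordinal (ltnW m1))).
by move=> /(congr1 val).
Qed.

(** A ray with a single out-neighbour is mapped onto it. Starting in [S], all iterates would stay on
    extreme rays and never become interior. *)
Lemma no_permuted_rays (S : {set 'I_m}) : (1 < m)%N -> primitive K A ->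
  S != finset.set0 ->
  ~ (forall i, i \in S -> exists2 k, k \in S &
       forall j, `[< dom K (A *m v i) (v j) >] = (j == k)).
Proof.
move=> m1 Apr S0 H; have [KA [p p0 /power_positiveP Pp]] := Apr.
have step i : i \in S -> exists2 k, k \in S & dom K (v k) (A *m v i).
  move=> iS; have [k kS kE] := H i iS; exists k => //.
  have [|c c0 ->] := @generate_support _ _ Kp _ _ vr (pred1 k) (A *m v i) (KA _ (Kv i)).
    by move=> j /asboolP; rewrite kE.
  by rewrite big_pred1_eq; apply: domZ => //; apply: dom_refl.
have steps k i : i \in S -> exists2 j, j \in S & dom K (v j) (A ^+ k *m v i).
  move=> iS; elim: k => [|k [j jS jd]].
    by exists i; rewrite // expr0 mul1mx; apply: dom_refl.
  have [l lS ld] := step j jS; exists l => //.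
  apply: (dom_trans Kc ld); rewrite mulmx_expS.
  exact: dom_mulmx.
have /set0Pn[i iS] := S0; have [j jS jd] := steps p i iS.
have Ai := Pp (v i) (Kv i) (ray_neq0 vr i).
exact: (ray_order_unit_neq m1 (order_unit_dom Kc (Kv j) jd Ai)).
Qed.

(** Any [t + 2 * s < 2 * m - 1] would already make [A ^+ N *m v y] interior. The bound is applied
    twice: [N = 2 * m - 1] yields the upper bound by contradiction, [N = 2 * m - 2] the equality
    case. *)
Lemma ray_digraph_F1 (N : nat) (y : 'I_m) : (2 < m)%N -> primitive K A ->
  (2 * m - 2 <= N)%N -> ~ order_unit K (A ^+ N *m v y) ->
  exists sg : 'I_m -> 'I_m,
    [/\ bijective sg, forall i : 'I_m, i = 0 :> nat -> sg i = y &
      forall i j, dom K (A *m v (sg i)) (v (sg j)) <-> F1 i j].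
Proof.
move=> m2 Apr mN nu; have [KA _] := Apr.
have [|||sg [sgb sg0 sgE]] := @wielandt_digraph m
    (fun i j => `[< dom K (A *m v i) (v j) >]) y m2.
- move=> i; have [|j ij] := dom_ray Kp vr (KA _ (Kv i)).
    by apply: primitive_neq0 => //; apply: ray_neq0 vr i.
  by exists j; apply/asboolP.
- by move=> S; apply: no_permuted_rays => //; apply: ltnW.
- move=> t s x s0 Wt Ws; rewrite leqNgt; apply/negP => ts; apply: nu.
  apply: (@primitive_order_unit_leq _ Apr (2 * s + t)) => //; first by lia.
  have := circuit_order_unit Apr s0 (Kv x) (ray_neq0 vr x) (dom_walk KA Ws).
  have K2 := cone_preserving_exp (2 * s) KA.
  rewrite mulmx_expD; apply: order_unit_dom => //.
    by apply: K2; apply: cone_preserving_exp.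
  exact: (dom_mulmx K2 (dom_walk KA Wt)).
exists sg; split=> // i j; rewrite -sgE; split=> /asboolP //.
Qed.

End Digraph.

Definition F1_rays (m : nat) (v : 'I_m -> 'cV[R]_3) A : Prop :=
  ray_system K v /\ forall i j, dom K (A *m v i) (v j) <-> F1 i j.

Lemma ray_system_comp (m : nat) (v : 'I_m -> 'cV[R]_3) (sg : 'I_m -> 'I_m) :
  bijective sg -> ray_system K v -> ray_system K (v \o sg).
Proof.
move=> sgb [ve vs vi]; have [g sgK gK] := sgb; split=> [i|x xe|i j /vi].
- exact: ve.
- by have [i [c [c0 ->]]] := vs x xe; exists (g i), c; rewrite /= gK.
- exact: (bij_inj sgb).
Qed.

Section F1Matrix.
Variables (m : nat) (v : 'I_m -> 'cV[R]_3) (A : 'M[R]_3).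
Hypotheses (m2 : (2 < m)%N) (vF : F1_rays v A) (KA : cone_preserving K A).
Let vr : ray_system K v. Proof. by case: vF. Qed.
Let vE i j : dom K (A *m v i) (v j) <-> F1 i j. Proof. by case: vF. Qed.
Let Kv i : K (v i) := ray_in vr i.
Let i0 : 'I_m := Ordinal (ltnW (ltnW m2)).
Let i1 : 'I_m := Ordinal (ltnW m2).
Let iL : 'I_m.
Proof. by exists m.-1; rewrite prednK //; apply: ltnW (ltnW m2). Defined.

Lemma F1_walk (i j : 'I_m) : (i <= j)%N -> dom K (A ^+ (j - i) *m v i) (v j).
Proof.
move=> ij; have [k] := ubnP (j - i); elim: k j ij => // k IH j ij jk.
have [ji|ij'] := leqP j i.
  have -> : j = i by apply/val_inj/eqP; rewrite eqn_leq ij ji.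
  by rewrite subnn expr0 mul1mx; apply: dom_refl.
have jm : (j.-1 < m)%N by apply: leq_ltn_trans (leq_pred _) (ltn_ord j).
have {}IH := IH (Ordinal jm) _ _; rewrite /= in IH.
have -> : (j - i = 1 + (j.-1 - i))%N by lia.
rewrite mulmx_expD expr1; apply: dom_trans (dom_mulmx KA (IH _ _)) _ => //; try lia.
by apply/vE; rewrite /F1 /= prednK ?eqxx //; lia.
Qed.

Lemma F1_last0 : dom K (A *m v iL) (v i0).
Proof. by apply/vE; rewrite /F1 /=; lia. Qed.

Lemma F1_last1 : dom K (A *m v iL) (v i1).
Proof. by apply/vE; rewrite /F1 /=; lia. Qed.

Let dom_add (p q : nat) x y z : dom K (A ^+ p *m x) y -> dom K (A ^+ q *m y) z ->
  dom K (A ^+ (q + p) *m x) z.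
Proof.
move=> xy yz; rewrite mulmx_expD; apply: dom_trans yz => //.
exact: dom_mulmx (cone_preserving_exp _ KA) xy.
Qed.

(** After [m - 1] steps the second ray dominates the first two; after [m - 1] more, the second again
    yields both and the first yields the last one. Three distinct rays are independent. *)
Lemma F1_1_order_unit : order_unit K (A ^+ (2 * (m - 1)) *m v i1).
Proof.
have d1L := @F1_walk i1 iL (ltac:(rewrite /=; lia)); rewrite /= in d1L.
have d0L := @F1_walk i0 iL isT; rewrite /= in d0L.
have A1 x : A *m x = A ^+ 1 *m x by rewrite expr1.
have d10 : dom K (A ^+ (m - 1) *m v i1) (v i0).
  have := F1_last0; rewrite A1 => /(dom_add d1L).
  by have -> : (1 + (m.-1 - 1) = m - 1)%N by lia.
have d11 : dom K (A ^+ (m - 1) *m v i1) (v i1).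
  have := F1_last1; rewrite A1 => /(dom_add d1L).
  by have -> : (1 + (m.-1 - 1) = m - 1)%N by lia.
rewrite subn0 -subn1 in d0L.
have -> : (2 * (m - 1) = (m - 1) + (m - 1))%N by lia.
have KN := cone_preserving_exp (m - 1 + (m - 1)) KA (Kv i1).
apply: (det3_order_unit Kp KN (Kv i0) (Kv i1) (Kv iL)
  (dom_add d11 d10) (dom_add d11 d11) (dom_add d10 d0L)).
by apply: (rays_det3_neq0 Kp vr); rewrite -val_eqE /=; lia.
Qed.

Lemma F1_primitive : primitive K A.
Proof.
split=> //; exists (3 * (m - 1))%N; first by lia.
have u1 := F1_1_order_unit.
(* [primitive_order_unit_leq] presupposes primitivity, which is the goal here; the single order unit
   [u1] is enough for the same monotonicity. *)
have mono (p q : nat) x : K x -> (p <= q)%N ->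
    order_unit K (A ^+ p *m x) -> order_unit K (A ^+ q *m x).
  move=> Kx pq; rewrite -(subnK pq); elim: (q - p)%N => // k IH u.
  rewrite addSn mulmx_expS.
  apply: (@order_unit_mulmx _ _ (A ^+ (2 * (m - 1)).-1 *m v i1)) (IH u) => //.
    exact: cone_preserving_exp.
  have /prednK e : (0 < 2 * (m - 1))%N by lia.
  by move: u1; rewrite -{1}e mulmx_expS.
have reach i : exists2 t, (t <= m - 1)%N & dom K (A ^+ t *m v i) (v i1).
  have [ii|] := posnP i.
    exists 1%N; first by lia.
    by rewrite expr1; apply/vE; rewrite /F1 /= ii.
  move=> ii; exists (m - i)%N; first by lia.
  have := @F1_walk i iL; rewrite /= => /(_ ltac:(have := ltn_ord i; lia)) d.
  have := F1_last1; rewrite -[A in A *m _]expr1 => /(dom_add d).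
  by have -> // : (1 + (m.-1 - i) = m - i)%N by have := ltn_ord i; lia.
apply/power_positiveP => x Kx x0.
have [i xi] := dom_ray Kp vr Kx x0; have [t tm ti] := reach i.
have KN k := cone_preserving_exp k KA.
apply: (order_unit_dom Kc (KN _ _ Kx) (dom_mulmx (KN _) xi)).
apply: (mono (2 * (m - 1) + t)%N) => //; first by lia.
rewrite mulmx_expD; apply: (order_unit_dom Kc _ (dom_mulmx (KN _) ti)) => //.
by do 2!apply/KN.
Qed.

End F1Matrix.
End Exponent.

(** * The lower bound for the digraph F_1 *)

Section LowerBound.
Context {R : realType}.
Variable K : set 'cV[R]_3.
Hypothesis Kp : proper_cone K.
Let Kc : convex_cone K := proper_convex Kp.

Lemma dom_det3_eq0 x y z w : K x -> K y -> det3 x y z != 0 -> det3 x y w = 0 ->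
  dom K (x + y) w /\ exists a b : R, w = a *: x + b *: y.
Proof.
move=> Kx Ky D D0.
have E : exists a b : R, w = a *: x + b *: y.
  exists (det3 w y z / det3 x y z), (det3 x w z / det3 x y z).
  apply: (scalerI D); rewrite cramer3 D0 scale0r addr0 scalerDr !scalerA.
  by rewrite ![det3 x y z * _]mulrC !divfK.
split=> //; have [a [b ->]] := E; apply: domD => //; apply: domZ => //.
  exact: dom_addl.
exact: dom_addr.
Qed.

(** If [K] had points [w1], [w2] strictly on both sides, a positive combination of them would lie in
    the plane and be dominated by [x + y]; then [w1] is dominated too, and [x], [y], [w1] are
    independent. *)
Lemma supporting_plane x y : K x -> K y -> ~ order_unit K (x + y) ->
  exists2 e : R, e != 0 & forall w, K w -> 0 <= e * det3 x y w.
Proof.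
move=> Kx Ky nu.
have [[w1 Kw1 p1]|H1] := pselect (exists2 w, K w & 0 < det3 x y w); last first.
  exists (-1) => [|w Kw]; first by rewrite oppr_eq0 oner_eq0.
  rewrite mulN1r oppr_ge0 leNgt; apply/negP => w0; apply: H1; by exists w.
exists 1 => [|w2 Kw2]; first exact: oner_neq0.
rewrite mul1r leNgt; apply/negP => n2; apply: nu.
pose w := (- det3 x y w2) *: w1 + det3 x y w1 *: w2.
have D0 : det3 x y w = 0 by rewrite /w det3D !det3Z; ring.
have [xw _] := dom_det3_eq0 Kx Ky (lt0r_neq0 p1) D0.
have c0 : 0 < - det3 x y w2 by rewrite oppr_gt0.
have xw1 : dom K (x + y) w1.
  apply: (dom_trans Kc xw); apply: (dom_trans Kc (dom_addl _ _)).
    by apply: coneZ => //; apply: ltW.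
  exact: dom_pscale.
apply: (det3_order_unit Kp (coneD Kc Kx Ky) Kx Ky Kw1 _ _ xw1) => //.
- exact: dom_addl.
- exact: dom_addr.
exact: lt0r_neq0.
Qed.

Section F1LowerBound.
Variables (m : nat) (v : 'I_m -> 'cV[R]_3) (A : 'M[R]_3).
Hypotheses (m2 : (2 < m)%N) (vF : F1_rays K v A) (Apr : primitive K A).
Let vr : ray_system K v. Proof. by case: vF. Qed.
Let vE i j : dom K (A *m v i) (v j) <-> F1 i j. Proof. by case: vF. Qed.
Let Kv i : K (v i) := ray_in vr i.
Let KA : cone_preserving K A. Proof. by case: Apr. Qed.

Lemma F1_image (i j : 'I_m) : j = i.+1 :> nat ->
  exists2 c : R, 0 < c & A *m v i = c *: v j.
Proof.
move=> ji; have Av0 := primitive_neq0 Kp Apr (Kv i) (ray_neq0 vr i).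
have [|c c0] := @generate_support _ _ Kp _ _ vr (pred1 j) (A *m v i) (KA (Kv i)).
  move=> k /vE; rewrite /F1 => /orP[/eqP k1|/andP[/eqP im _]].
    by apply/eqP/val_inj; rewrite /= k1.
  by have := ltn_ord j; rewrite ji im ltnn.
rewrite big_pred1_eq => AE; exists (c j) => //.
rewrite lt_def c0 andbT; apply: contra_neq Av0 => cj.
by rewrite AE cj scale0r.
Qed.

Lemma F1_last_image (i j k : 'I_m) : i.+1 = m -> j = 0 :> nat -> k = 1 :> nat ->
  exists a b : R, [/\ 0 < a, 0 <= b & A *m v i = a *: v j + b *: v k].
Proof.
move=> im j0 k1; have jk : k != j by rewrite -val_eqE /= j0 k1.
have [|c c0] := @generate_support _ _ Kp _ _ vr (pred2 j k) (A *m v i) (KA (Kv i)).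
  move=> l /vE; rewrite /F1 => /orP[/eqP k1'|/andP[_ /orP[]/eqP l0]].
  - by have := ltn_ord l; rewrite k1' im ltnn.
  - by apply/orP; left; apply/eqP/val_inj; rewrite /= l0.
  - by apply/orP; right; apply/eqP/val_inj; rewrite /= l0.
rewrite (bigD1 j) /= ?eqxx // (bigD1 k) /= ?eqxx ?orbT // big1 ?addr0; last first.
  by move=> l /andP[/andP[/orP[/eqP ->|/eqP ->]]]; rewrite eqxx.
move=> AE; exists (c j), (c k); split=> //.
rewrite lt_def c0 andbT; apply/eqP => cj.
have : dom K (A *m v i) (v j) by apply/vE; rewrite /F1 im j0 eqxx orbT.
rewrite AE cj scale0r add0r => d.
suff /(ray_inj vr) kj : dom K (v k) (v j) by rewrite kj eqxx in jk.
by apply: dom_trans d => //; apply: domZ_ge0 => //; apply: dom_refl.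
Qed.

(* Adjacency of [x_1], [x_2] is propagated by [A]: the supporting plane of
   [x_k], [x_(k+1)] is mapped to one of [A K] at [x_(k+1)], [x_(k+2)], and it
   cannot separate [x_1] from [A K] because [A x_m] lies on the edge [x_1 x_2]. *)
Lemma F1_consecutive_face (i j : 'I_m) : j = i.+1 :> nat ->
  ~ order_unit K (v i + v j).
Proof.
have lt0m : (0 < m)%N by lia.
have lt1m : (1 < m)%N by lia.
have ltLm : (m.-1 < m)%N by lia.
pose i0 := Ordinal lt0m; pose i1 := Ordinal lt1m; pose iL := Ordinal ltLm.
have [a [b [a0 b0 AL]]] := @F1_last_image iL i0 i1 (prednK lt0m) erefl erefl.
have AL0 : dom K (A *m v iL) (v i0) by apply/vE; rewrite /F1 /=; lia.
have AL1 : dom K (A *m v iL) (v i1) by apply/vE; rewrite /F1 /=; lia.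
have AL_only l : dom K (A *m v iL) (v l) -> l = i0 \/ l = i1.
  move/vE; rewrite /F1 /= => h; have := ltn_ord l => lm.
  have [l0|l1] : (l = 0 :> nat) \/ (l = 1 :> nat) by lia.
    by left; apply: val_inj.
  by right; apply: val_inj.
have [k] := ubnP i; elim: k i j => // k IH i j ik ji.
have [ii0|i_gt0] := posnP i.
  (* Otherwise [A *m v iL], which dominates [v i0 + v i1], would also dominate the third ray, an arc
     absent from [F1]. *)
  move=> [_ u]; have [ei ej] : i = i0 /\ j = i1.
    by split; apply: val_inj; rewrite //= ji ii0.
  have := dom_trans Kc (domD Kc AL0 AL1) (_ : dom K (v i0 + v i1) (v (Ordinal m2))).
  by rewrite -ei -ej => /(_ (u _))/AL_only[] /(congr1 val).
have pm : (i.-1 < m)%N by have := ltn_ord i; lia.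
pose p := Ordinal pm.
have ip : i = p.+1 :> nat by rewrite /= prednK.
have pk : (p < k)%N by rewrite /=; lia.
have [e e0 eK] := supporting_plane (Kv p) (Kv i) (IH p i pk ip).
have [c c0 Ap] := F1_image ip; have [d d0 Ai] := F1_image ji.
pose dA := det3 (col 0 A) (col 1 A) (col ord_max A).
have cd0 : 0 < c * d by apply: mulr_gt0.
have phiA w : c * d * det3 (v i) (v j) (A *m w) = dA * det3 (v p) (v i) w.
  by rewrite -det3_mulmx Ap Ai /det3 !mxE; ring.
(* [A] may reverse orientation, so [s] is [e] or [- e] according to the sign of its determinant
   [dA]. *)
have [s s0 sA] : exists2 s : R, s != 0 & forall w, K w -> 0 <= s * det3 (v i) (v j) (A *m w).
  have [dA0|dA0] := leP 0 dA.
    exists e => // w Kw; rewrite -(pmulr_rge0 _ cd0) mulrCA phiA mulrCA.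
    by apply: mulr_ge0 => //; apply: eK.
  exists (- e) => [|w Kw]; first by rewrite oppr_eq0.
  rewrite -(pmulr_rge0 _ cd0) mulrCA phiA mulrCA mulNr mulrN -mulNr.
  by apply: mulr_ge0; [lra|exact: eK].
move=> u; have pi_neq : p != i by rewrite -val_eqE /=; lia.
have pj_neq : p != j by rewrite -val_eqE /=; lia.
have ij_neq : i != j by rewrite -val_eqE /=; lia.
pose f w := s * det3 (v i) (v j) w.
have fD x y : f (x + y) = f x + f y by rewrite /f det3D mulrDr.
have fZ t x : f (t *: x) = t * f x by rewrite /f det3Z mulrCA.
have fS (l : 'I_m) : (0 < l)%N -> 0 <= f (v l).
  move=> l0; have lm : (l.-1 < m)%N := leq_ltn_trans (leq_pred _) (ltn_ord l).
  have [t t0 Al] := @F1_image (Ordinal lm) l (esym (prednK l0)).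
  by rewrite -(pmulr_rge0 _ t0) -fZ -Al; apply: sA.
have fij : f (v i + v j) = 0 by rewrite fD /f det3xyx det3xyy !mulr0 addr0.
(* If [v i0] is on the nonnegative side, [f] is nonnegative on [K] and vanishes at an order unit;
   then [f] is zero, against the independence of [v p], [v i], [v j]. *)
have [f0|f0] := leP 0 (f (v i0)).
  have fK w : K w -> 0 <= f w.
    move=> Kw; have [t t0 ->] := ray_generate Kp vr Kw.
    elim/big_ind: _ => [|x y x0 y0|l _].
    - by rewrite -(subrr (v i0)) -scaleN1r fD fZ mulN1r subrr.
    - by rewrite fD; apply: addr_ge0.
    - rewrite fZ; apply: mulr_ge0 => //; have [l0|] := posnP l; last exact: fS.
      by have -> : l = i0 by apply: val_inj.
  have f_le0 w : f w <= 0.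
    have [_ /(_ w)[t t0 /fK]] := u.
    by rewrite -scaleN1r fD !fZ fij mulr0 add0r mulN1r oppr_ge0.
  have /eqP : f (v p) = 0.
    apply/le_anti/andP; split; first exact: f_le0.
    by have := f_le0 (- v p); rewrite -scaleN1r fZ mulN1r oppr_le0.
  rewrite mulf_eq0 (negPf s0) /=; apply/negP; rewrite -det3_rot.
  by apply: (rays_det3_neq0 Kp vr).
have nf0 : 0 < - f (v i0) by rewrite oppr_gt0.
have f1 : 0 < f (v i1).
  have := sA _ (Kv iL); rewrite -/(f _) AL fD !fZ => h.
  have bf : 0 < b * f (v i1).
    by apply: lt_le_trans (mulr_gt0 a0 nf0) _; rewrite mulrN -subr_ge0 opprK addrC.
  have b1 : 0 < b.
    by rewrite lt_def b0 andbT; apply: contraTneq bf => ->; rewrite mul0r ltxx.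
  by rewrite pmulr_rgt0 in bf.
have i_ge2 : (1 < i)%N.
  rewrite ltn_neqAle i_gt0 andbT; apply: contraTneq f1 => i1E.
  have -> : i1 = i by apply: val_inj.
  by rewrite /f det3xyx mulr0 ltxx.
(* [z] is where the edge from [v i0] to [v i1] crosses the plane of [v i], [v j]. Being dominated by
   [A *m v iL], it dominates no ray except [v i0] and [v i1]. If both coordinates [g], [h] are
   positive, it dominates [v i]; if one is nonpositive, the other ray dominates [z], hence
   [v i0]. *)
pose z := f (v i1) *: v i0 + (- f (v i0)) *: v i1.
have Kz0 : K (f (v i1) *: v i0) by apply: coneZ => //; apply: ltW.
have Kz1 : K ((- f (v i0)) *: v i1) by apply: coneZ => //; apply: ltW.
have Kz : K z by apply: coneD.
have fz : f z = 0 by rewrite /z fD !fZ mulNr [X in X - _]mulrC subrr.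
have D1 : det3 (v i) (v j) (v i1) != 0.
  by apply: contraTneq f1 => D; rewrite /f D mulr0 ltxx.
have Dz : det3 (v i) (v j) z = 0.
  by apply/eqP; move/eqP: fz; rewrite mulf_eq0 (negPf s0).
have [_ [g [h zE]]] := dom_det3_eq0 (Kv i) (Kv j) D1 Dz.
have z0 : dom K z (v i0).
  by apply: (dom_trans Kc (dom_addl _ Kz1)); apply: dom_pscale.
have Lz : dom K (A *m v iL) z.
  by apply: domD => //; apply: domZ_ge0 => //; apply: ltW.
have Lpos y (t q : R) (l : 'I_m) : K y -> z = t *: v l + q *: y -> 0 < t -> 0 <= q ->
    (1 < l)%N -> False.
  move=> Ky zE' t0 q0 l1.
  have zl : dom K z (v l).
    rewrite zE'; apply: (dom_trans Kc (dom_addl _ (coneZ Kc q0 Ky))).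
    exact: dom_pscale.
  by have [lE|lE] := AL_only _ (dom_trans Kc Lz zl); rewrite lE in l1.
have Lneg y (t q : R) (l : 'I_m) : K y -> z = t *: v l + q *: y -> q <= 0 -> (1 < l)%N -> False.
  move=> Ky zE' q0 l1; have Kq : K ((- q) *: y) by apply: coneZ; rewrite // oppr_ge0.
  have E : t *: v l = z + (- q) *: y by rewrite zE' scaleNr addrK.
  have ld : dom K (v l) (v i0).
    apply: (dom_trans Kc _ z0); apply: (@dom_trans _ _ _ Kc (t *: v l)).
      by apply: domZ => //; apply: dom_refl.
    by rewrite E; apply: dom_addl.
  by move: l1; rewrite (ray_inj vr ld).
have j_ge2 : (1 < j)%N by rewrite ji; apply: leqW.
have [h0|h0] := leP h 0; first exact: (Lneg _ _ _ _ (Kv j) zE h0 i_ge2).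
have zE2 : z = h *: v j + g *: v i by rewrite addrC.
have [g0|g0] := leP g 0; first exact: (Lneg _ _ _ _ (Kv i) zE2 g0 j_ge2).
exact: (Lpos _ _ _ _ (Kv j) zE g0 (ltW h0) i_ge2).
Qed.

Lemma F1_not_power_positive : ~ power_positive K A (2 * m - 2).
Proof.
have lt0m : (0 < m)%N by lia.
have lt1m : (1 < m)%N by lia.
have ltLm : (m.-1 < m)%N by lia.
have ltLm' : (m.-2 < m)%N by lia.
pose i0 := Ordinal lt0m; pose i1 := Ordinal lt1m.
pose iL := Ordinal ltLm; pose iL' := Ordinal ltLm'.
have up (k : nat) (i j : 'I_m) : j = (i + k)%N :> nat -> dom K (v j) (A ^+ k *m v i).
  elim: k i => [|k IH] i ji.
    have -> : j = i by apply: val_inj; rewrite /= ji addn0.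
    by rewrite expr0 mul1mx; apply: dom_refl.
  have lm : (i.+1 < m)%N by have := ltn_ord j; lia.
  have [c c0 Ai] := @F1_image i (Ordinal lm) erefl.
  rewrite mulmx_expSr Ai -scalemxAr; apply: domZ_ge0 (ltW c0) _ => //.
  by apply: IH; rewrite ji /=; lia.
have [a [b [a0 b0 AL]]] := @F1_last_image iL i0 i1 (prednK lt0m) erefl erefl.
move=> /(power_positiveP Kp) /(_ (v i0) (Kv i0) (ray_neq0 vr i0)).
(* [m - 1] steps lead from [x_1] to [x_m], one step onto the edge [x_1 x_2], and [m - 2] steps carry
   this edge to [x_(m-1) x_m]. *)
have -> : (2 * m - 2 = m.-2 + (1 + m.-1))%N by lia.
rewrite !mulmx_expD expr1.
have KN k := cone_preserving_exp k KA.
set w := A ^+ m.-2 *m _ => wu.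
have LL : iL = iL'.+1 :> nat by rewrite /=; lia.
apply: (F1_consecutive_face LL).
apply: (order_unit_dom Kc (coneD Kc (Kv iL') (Kv iL)) _ wu).
apply: (@dom_trans _ _ _ Kc (A ^+ m.-2 *m (v i0 + v i1))).
  rewrite mulmxDr; apply: domD => //.
    by apply: (dom_trans Kc (dom_addl _ (Kv iL))); apply: up.
  by apply: (dom_trans Kc (dom_addr _ (Kv iL'))); apply: up => /=; lia.
apply: dom_mulmx; first exact: KN.
apply: (@dom_trans _ _ _ Kc (A *m v iL)).
  rewrite AL; apply: domD => //; apply: domZ_ge0 => //; rewrite ?ltW //.
    exact: dom_addl.
  exact: dom_addr.
by apply: dom_mulmx => //; apply: up.
Qed.

End F1LowerBound.
End LowerBound.

(** * Maximal exponents *)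

(** Supplies the multiplier in the elimination step of [positive_functional]. The finitely many
    strict inequalities leave room above the largest value; dividing by [a + 1] rather than [a]
    covers [a = 0]. *)
Lemma strict_bound (R : realFieldType) (T : eqType) (a b : R) (f : T -> R) (x : T)
    (s : seq T) : 0 <= a -> (forall y, y \in x :: s -> a * f y < b) ->
  exists2 t : R, a * t < b & forall y, y \in x :: s -> f y < t.
Proof.
move=> a0 H.
suff [t [xt ts tb]] : exists t, [/\ f x < t, forall y, y \in s -> f y < t & a * t < b].
  by exists t => // y; rewrite inE => /orP[/eqP ->//|]; apply: ts.
have up y : a * f y < b -> exists2 t, f y < t & a * t < b.
  move=> h; have a1 : 0 < a + 1 by rewrite ltr_wpDl.
  exists (f y + (b - a * f y) / (a + 1)).
    by rewrite ltrDl divr_gt0 // subr_gt0.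
  rewrite mulrDr -ltrBrDl mulrA ltr_pdivrMr // mulrC ltr_pM2l ?subr_gt0 //.
  by rewrite ltrDl.
elim: s H => [|z s IH] H.
  have [|t] := up x; first by apply: H; rewrite inE eqxx.
  by exists t.
have [|t [xt ts tb]] := IH.
  by move=> y ys; apply: H; move: ys; rewrite !inE => /orP[->//|->]; rewrite !orbT.
have [|t' zt tb'] := up z; first by apply: H; rewrite !inE eqxx orbT.
exists (Num.max t t'); split.
- by rewrite lt_max xt.
- by move=> y; rewrite inE lt_max => /orP[/eqP ->|/ts ->//]; rewrite zt orbT.
- by case: (leP t t').
Qed.

Section PositiveFunctional.
Context {R : realType} {n : nat}.
Variable K : set 'cV[R]_n.
Hypothesis Kp : proper_cone K.
Let Kc : convex_cone K := proper_convex Kp.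

(* Fourier-Motzkin elimination: a functional positive on the list but not on
   [v] is corrected by one that is positive on the pairwise eliminations. *)
Lemma positive_functional (x : 'cV[R]_n) (s : seq 'cV[R]_n) :
  (forall v, v \in x :: s -> K v /\ v != 0) ->
  exists phi : 'rV[R]_n, forall v, v \in x :: s -> 0 < (phi *m v) 0 0.
Proof.
have [k] := ubnP (size s); elim: k x s => // k IH x [|y s] sk H.
  exists x^T => v; rewrite inE => /eqP ->.
  have [_ x0] := H x (mem_head _ _).
  rewrite mxE lt_def sumr_ge0 ?andbT => [|i _]; last by rewrite mxE -expr2 sqr_ge0.
  apply: contra_neq x0 => /eqP.
  rewrite psumr_eq0 => [/allP h|i _]; last by rewrite mxE -expr2 sqr_ge0.
  apply/matrixP => i j; rewrite [j]ord1 mxE.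
  have := h i (mem_index_enum _); rewrite mxE -expr2 expf_eq0 /= => /eqP //.
have Hs v : v \in y :: s -> K v /\ v != 0 by move=> vs; apply: H; rewrite inE vs orbT.
have [phi phiP] := IH y s sk Hs.
have [Kx x0] := H x (mem_head _ _).
have [xpos|xneg] := ltP 0 ((phi *m x) 0 0).
  by exists phi => v; rewrite inE => /orP[/eqP ->//|]; apply: phiP.
pose a := - (phi *m x) 0 0.
have a0 : 0 <= a by rewrite oppr_ge0.
(* [w v] is the combination of [v] and [x] on which [phi] vanishes; it is nonzero because [K] is
   pointed. *)
pose w (v : 'cV[R]_n) := a *: v + (phi *m v) 0 0 *: x.
have wK v : v \in y :: s -> K (w v) /\ w v != 0.
  move=> vs; have [Kv v0] := Hs v vs; have pv := phiP v vs.
  have K1 := coneZ Kc a0 Kv; have K2 := coneZ Kc (ltW pv) Kx.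
  split; first exact: coneD.
  apply: contra_neq x0 => wv0.
  have K1' : K (- ((phi *m v) 0 0 *: x)).
    by rewrite -(addrK ((phi *m v) 0 0 *: x) (a *: v)) -/(w v) wv0 add0r in K1.
  have /eqP := cone_pointed Kp K2 K1'.
  by rewrite scaler_eq0 gt_eqF //= => /eqP.
have phiL (psi : 'rV[R]_n) (c d : R) (u v : 'cV[R]_n) :
    (psi *m (c *: u + d *: v)) 0 0 = c * (psi *m u) 0 0 + d * (psi *m v) 0 0.
  by rewrite mulmxDr -!scalemxAr !mxE.
have [||psi psiP] := IH (w y) (map w s); first by rewrite size_map.
  by move=> _ /(mapP (s := y :: s))[v vs ->]; apply: wK.
have psiP' v : v \in y :: s -> 0 < a * (psi *m v) 0 0 + (phi *m v) 0 0 * (psi *m x) 0 0.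
  by move=> vs; rewrite -phiL; apply: psiP; apply: (map_f w vs).
have [v vs|t tx tP] := @strict_bound R _ a ((psi *m x) 0 0)
    (fun v => - (psi *m v) 0 0 / (phi *m v) 0 0) y s a0.
  by rewrite mulrA ltr_pdivrMr ?phiP // mulrN -subr_gt0 opprK addrC [X in _ + X]mulrC psiP'.
exists (psi + t *: phi) => v.
have -> : ((psi + t *: phi) *m v) 0 0 = (psi *m v) 0 0 + t * (phi *m v) 0 0.
  by rewrite mulmxDl -scalemxAl !mxE.
rewrite inE => /orP[/eqP ->|vs].
  by move: tx; rewrite /a mulNr -subr_gt0 opprK [_ * t]mulrC.
by have := tP v vs; rewrite ltr_pdivrMr ?phiP // -subr_gt0 opprK addrC.
Qed.

End PositiveFunctional.

Lemma nat_bounded_max (S : set nat) (N : nat) : S !=set0 -> ubound S N ->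
  exists2 p, is_max S p & (p <= N)%N.
Proof.
move=> [q Sq] SN.
have exP : exists n, `[< S n >] by exists q; apply/asboolP.
have ubP n : `[< S n >] -> (n <= N)%N by move=> /asboolP /SN.
case: (ex_maxnP exP ubP) => p /asboolP Sp pmax; exists p; last exact: SN.
by split=> // n Sn; apply: pmax; apply/asboolP.
Qed.

Lemma is_max_unique (S : set nat) (p q : nat) : is_max S p -> is_max S q -> p = q.
Proof.
by move=> [Sp pU] [Sq qU]; apply/eqP; rewrite eqn_leq; apply/andP; split; [exact: qU|exact: pU].
Qed.

(** * The upper bound, its equality case, and the translation to sets of rays *)

Section MaxExponent.
Context {R : realType}.
Variables (m : nat) (K : set 'cV[R]_3).
Hypotheses (m2 : (2 < m)%N) (Kp : proper_cone K).
Let Kc : convex_cone K := proper_convex Kp.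

Section Matrix.
Variables (v : 'I_m -> 'cV[R]_3) (A : 'M[R]_3).
Hypotheses (vr : ray_system K v) (Apr : primitive K A).
Let KA : cone_preserving K A. Proof. by case: Apr. Qed.
Let Kv i : K (v i) := ray_in vr i.

Lemma power_positive_rays (p : nat) :
  (forall i, order_unit K (A ^+ p *m v i)) -> power_positive K A p.
Proof.
move=> H; apply/(power_positiveP Kp) => x Kx x0.
have [i xi] := dom_ray Kp vr Kx x0; have KN := cone_preserving_exp p KA.
exact: (order_unit_dom Kc (KN _ Kx) (dom_mulmx KN xi) (H i)).
Qed.

(** Failure at some [v y] forces [F1] with [y] as first vertex; but then [A *m v y] dominates the
    second ray, which becomes interior after [2 * (m - 1)] further steps. *)
Lemma primitive_power_positive : power_positive K A (2 * m - 1).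
Proof.
apply: power_positive_rays => y; apply: contrapT => nu.
have mN : (2 * m - 2 <= 2 * m - 1)%N by lia.
have [sg [sgb sg0 sgE]] := ray_digraph_F1 Kp vr m2 Apr mN nu.
have vF : F1_rays K (v \o sg) A by split=> //; apply: ray_system_comp.
have lt0m : (0 < m)%N by lia.
have lt1m : (1 < m)%N by lia.
pose i0 := Ordinal lt0m; apply: nu.
have := F1_1_order_unit Kp m2 vF KA; set i1 := Ordinal _ => u1.
have d01 : dom K (A *m (v \o sg) i0) ((v \o sg) i1) by apply/sgE.
have -> : (2 * m - 1 = (2 * (m - 1)).+1)%N by lia.
rewrite -(sg0 i0 erefl) mulmx_expSr.
have KN := cone_preserving_exp (2 * (m - 1)) KA.
by apply: (order_unit_dom Kc _ (dom_mulmx KN d01) u1); apply/KN/KA/Kv.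
Qed.

Lemma primitive_exponent : exists2 q, exponent K A q & (q <= 2 * m - 1)%N.
Proof.
have exP : exists n, (0 < n)%N && `[< power_positive K A n >].
  exists (2 * m - 1)%N; apply/andP; split; first by lia.
  by apply/asboolP/primitive_power_positive.
case: (ex_minnP exP) => q /andP[q0 /asboolP Pq] qmin; exists q.
  by split=> // l l0 Pl; apply: qmin; rewrite l0; apply/asboolP.
apply: qmin; apply/andP; split; first by lia.
by apply/asboolP/primitive_power_positive.
Qed.

Lemma exponent_leq (q : nat) : exponent K A q -> (q <= 2 * m - 1)%N.
Proof.
by move=> [_ _]; apply; [lia|exact: primitive_power_positive].
Qed.

Lemma exponent_F1 : F1_rays K v A -> exponent K A (2 * m - 1).
Proof.
move=> vF; split; [by lia|exact: primitive_power_positive|move=> q q0 Pq].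
rewrite leqNgt; apply/negP => qm; apply: (F1_not_power_positive Kp m2 vF Apr).
by apply: (power_positive_leq Kp Apr _ Pq); lia.
Qed.

Lemma exponent_extremal : exponent K A (2 * m - 1) -> exists w : 'I_m -> 'cV[R]_3, F1_rays K w A.
Proof.
move=> [_ _ H].
have [y nu] : exists y, ~ order_unit K (A ^+ (2 * m - 2) *m v y).
  apply: contrapT => N.
  have := H (2 * m - 2)%N; rewrite leqNgt => /(_ _ _)/negP; apply; try lia.
  by apply: power_positive_rays => i; apply: contrapT => ni; apply: N; exists i.
have [sg [sgb _ sgE]] := ray_digraph_F1 Kp vr m2 Apr (leqnn _) nu.
by exists (v \o sg); split=> //; apply: ray_system_comp.
Qed.

End Matrix.

(** Needed for the maximum defining the exponent of [K] to be over a nonempty set. The witness has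
    rank one: an interior vector times a functional positive on all rays. *)
Lemma exists_primitive (v : 'I_m -> 'cV[R]_3) : ray_system K v ->
  exists A, primitive K A.
Proof.
move=> vr; have lt0m : (0 < m)%N by lia.
have [phi phiP] := @positive_functional _ _ _ Kp (v (Ordinal lt0m)) (map v (enum 'I_m))
  (ltac:(move=> u; rewrite inE => /orP[/eqP ->|/mapP[i _ ->]];
    split; by [apply: ray_in vr _|apply: ray_neq0 vr _])).
have pv i : 0 < (phi *m v i) 0 0.
  by apply: phiP; rewrite inE map_f ?orbT // mem_enum.
have [u [Ku uu]] := exists_order_unit Kp.
have AE x : (u *m phi) *m x = (phi *m x) 0 0 *: u.
  by rewrite -mulmxA {1}[phi *m x]mx11_scalar mul_mx_scalar.
have phi_ge0 x : K x -> 0 <= (phi *m x) 0 0.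
  move=> Kx; have [c c0 ->] := ray_generate Kp vr Kx.
  rewrite mulmx_sumr summxE sumr_ge0 // => i _.
  by rewrite -scalemxAr mxE mulr_ge0 // ltW.
have phi_gt0 x : K x -> x != 0 -> 0 < (phi *m x) 0 0.
  move=> Kx x0; have [i [c c0 /phi_ge0]] := dom_ray Kp vr Kx x0.
  have -> : (phi *m (c *: x - v i)) 0 0 = c * (phi *m x) 0 0 - (phi *m v i) 0 0.
    by rewrite mulmxBr -scalemxAr !mxE.
  rewrite subr_ge0 => /(lt_le_trans (pv i)) cx.
  rewrite lt_def phi_ge0 // andbT; apply: contraTneq cx => ->.
  by rewrite mulr0 ltxx.
exists (u *m phi); split=> [x Kx|].
  by rewrite AE; apply: coneZ => //; apply: phi_ge0.
exists 1%N => //; apply/(power_positiveP Kp) => x Kx x0; rewrite expr1 AE.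
have p0 := phi_gt0 x Kx x0.
split=> [|w]; first by apply: coneZ => //; apply: ltW.
by apply: (dom_trans Kc _ (uu w)); apply: dom_pscale.
Qed.

Lemma cone_exponent_leq (v : 'I_m -> 'cV[R]_3) (q : nat) : ray_system K v ->
  cone_exponent K q -> (q <= 2 * m - 1)%N.
Proof. by move=> vr [[A Apr Aq] _]; apply: exponent_leq vr Apr _ Aq. Qed.

Lemma exists_cone_exponent (v : 'I_m -> 'cV[R]_3) : ray_system K v ->
  exists q, cone_exponent K q.
Proof.
move=> vr; have [A Apr] := exists_primitive vr.
have [q Aq _] := primitive_exponent vr Apr.
have [||p pmax _] := @nat_bounded_max
  [set q | exists2 A, primitive K A & exponent K A q] (2 * m - 1).
- by exists q; exists A.
- by move=> l [B Bpr Bl]; apply: exponent_leq vr Bpr _ Bl.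
- by exists p.
Qed.

Lemma F1_cone_exponent (v : 'I_m -> 'cV[R]_3) A :
  F1_rays K v A -> primitive K A -> cone_exponent K (2 * m - 1).
Proof.
move=> vF Apr; have vr : ray_system K v by case: vF.
split; first by exists A => //; apply: exponent_F1 vF.
by move=> l [B Bpr Bl]; apply: exponent_leq vr Bpr _ Bl.
Qed.

Lemma bij_ray_system (phi : set 'cV[R]_3 -> 'I_m) :
  set_bij (extreme_rays K) [set: 'I_m] phi ->
  exists2 v : 'I_m -> 'cV[R]_3, ray_system K v & forall i, phi (Phi K (v i)) = i.
Proof.
move=> [_ phi_inj phi_surj].
have /choice[v vP] : forall i, exists x, extreme_vector K x /\ phi (Phi K x) = i.
  by move=> i; have [_ [x ex <-] <-] := phi_surj i I; exists x.
exists v => [|i]; last by case: (vP i).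
have Ke x : extreme_vector K x -> K x by case.
have ray i : extreme_rays K (Phi K (v i)) by exists (v i) => //; case: (vP i).
have ve i : extreme_vector K (v i) by case: (vP i).
split=> // [x ex|i j /(Phi_subset Kc (Ke _ (ve i)) (Ke _ (ve j))) vij].
  exists (phi (Phi K x)); have [vpe vpE] := vP (phi (Phi K x)).
  have E : Phi K (v (phi (Phi K x))) = Phi K x.
    by apply: phi_inj; rewrite ?inE //; exists x.
  have /(extreme_vectorP Kc)[Kv v0 vext] := vpe.
  have [Kx x0 _] := ex.
  have [||c c0 xE] := vext x => //.
    by apply/(Phi_subset Kc) => //; rewrite E.
  exists c; split=> //; rewrite lt_def c0 andbT; apply: contra_neq x0 => c00.
  by rewrite xE c00 scale0r.
have [_ _ vi] := ve i.
have vjc : dom K (v i) (v j) by apply/(Phi_subset Kc) => //; apply: Ke.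
have [Kj vj0 _] := ve j.
have /(extreme_vectorP Kc)[_ _ /(_ _ Kj vjc)[c c0 vjE]] := ve i.
have cp : 0 < c.
  by rewrite lt_def c0 andbT; apply: contra_neq vj0 => c00; rewrite vjE c00 scale0r.
have : Phi K (v i) = Phi K (v j).
  apply/seteqP; split=> //; apply/(Phi_subset Kc) => //; first exact: Ke.
  by rewrite vjE; apply: dom_pscale.
by move/(congr1 phi); rewrite (vP i).2 (vP j).2.
Qed.

Lemma ray_system_bij (v : 'I_m -> 'cV[R]_3) : ray_system K v ->
  exists2 phi : set 'cV[R]_3 -> 'I_m,
    set_bij (extreme_rays K) [set: 'I_m] phi & forall i, phi (Phi K (v i)) = i.
Proof.
move=> vr; have Kv i := ray_in vr i.
have lt0m : (0 < m)%N by lia.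
pose phi E := xget (Ordinal lt0m) [set i | E = Phi K (v i)].
have Phi_inj i j : Phi K (v i) = Phi K (v j) -> i = j.
  move=> E; apply: (ray_inj vr); apply/(Phi_subset Kc) => //.
  by rewrite E.
have phiK i : phi (Phi K (v i)) = i.
  rewrite /phi; case: xgetP => [j _ /= /Phi_inj //|/(_ i)]; by case.
have ex E : extreme_rays K E -> exists i, E = Phi K (v i).
  move=> [x ex <-]; have [_ /(_ x ex)[i [c [c0 xE]]] _] := vr.
  exists i; have Kx : K x by case: ex.
  apply/seteqP; split; apply/(Phi_subset Kc) => //; rewrite xE.
    by apply: domZ => //; apply: dom_refl.
  exact: dom_pscale.
exists phi => //; split=> // [E F|i _].
  by rewrite !inE => /ex[i ->] /ex[j ->]; rewrite !phiK => ->.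
by exists (Phi K (v i)) => //; exists (v i) => //; case: vr.
Qed.

Lemma ray_arcE A (v : 'I_m -> 'cV[R]_3) (i j : 'I_m) : cone_preserving K A ->
  ray_system K v ->
  ray_arc K A (Phi K (v i)) (Phi K (v j)) <-> dom K (A *m v i) (v j).
Proof.
move=> KA vr; have Kv k := ray_in vr k; have [ve _ _] := vr; split; last first.
  by move=> d; exists (v i), (v j); split=> //; apply/(Phi_subset Kc) => //; apply: KA.
move=> [x [y [ex ey Ei Ej /(Phi_subset Kc) d]]].
have Kx : K x by case: ex.
have Ky : K y by case: ey.
apply: (@dom_trans _ _ _ Kc (A *m x)).
  by apply: dom_mulmx => //; apply/(Phi_subset Kc) => //; rewrite Ei.
apply: (@dom_trans _ _ _ Kc y); first by apply: d => //; apply: KA.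
by apply/(Phi_subset Kc) => //; rewrite Ej.
Qed.

Lemma digraph_iso_F1 A : cone_preserving K A ->
  digraph_iso (extreme_rays K) (ray_arc K A) [set: 'I_m] (fun i j => F1 i j) <->
  exists v : 'I_m -> 'cV[R]_3, F1_rays K v A.
Proof.
move=> KA; split=> [[phi phib phiE]|[v [vr vE]]].
  have [v vr vK] := bij_ray_system phib.
  exists v; split=> // i j; rewrite -ray_arcE //.
  have ray k : extreme_rays K (Phi K (v k)) by exists (v k) => //; case: vr.
  by rewrite phiE // !vK.
have [phi phib phiK] := ray_system_bij vr; exists phi => // E F.
have [_ _ phis] := phib; have [_ phiI _] := phib.
have surj G : extreme_rays K G -> G = Phi K (v (phi G)).
  move=> rG; apply: phiI; rewrite ?inE ?phiK //.
  by exists (v (phi G)) => //; case: vr.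
by move=> /surj -> /surj ->; rewrite ray_arcE // !phiK.
Qed.

Lemma polycone_ray_system : polycone m K <-> exists v : 'I_m -> 'cV[R]_3, ray_system K v.
Proof.
have lt0m : (0 < m)%N by lia.
split=> [[_ /card_set_bijP[f [fS fI fs]]]|[v vr]]; last first.
  split=> //; have [phi [phiS phiI phis] _] := ray_system_bij vr.
  apply/card_set_bijP; exists (fun E => phi E : nat); split.
  - by move=> E _; exact: ltn_ord.
  - by move=> E F EK FK /val_inj; apply: phiI.
  - by move=> i im; have [E EK Ei] := phis (Ordinal im) I; exists E; rewrite // Ei.
(* The default is taken only off [extreme_rays K], where [f E < m] is not known. *)
pose phi E : 'I_m := insubd (Ordinal lt0m) (f E).
have phiE E : extreme_rays K E -> phi E = f E :> nat.
  by move=> /fS Em; rewrite /phi val_insubd Em.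
have [|v vr _] := @bij_ray_system phi; last by exists v.
split=> // [E F EK FK /(congr1 val) /=|i _].
  by rewrite (phiE _ (set_mem EK)) (phiE _ (set_mem FK)); apply: fI.
have [E EK Ei] := fs i (ltn_ord i); exists E => //.
by apply: val_inj; rewrite /= phiE.
Qed.

End MaxExponent.

(** * The spiral family *)

Section Spiral.
Context {R : realType}.
Variables (theta r : R).
Local Notation x := (gen_vector theta r).
Local Notation c := (cos theta).
Local Notation s := (sin theta).

Lemma gen_vector0 j : x j 0 0 = r ^+ j * cos (j%:R * theta). Proof. by rewrite mxE. Qed.
Lemma gen_vector1 j : x j 1 0 = r ^+ j * sin (j%:R * theta). Proof. by rewrite mxE. Qed.
Lemma gen_vector2 j : x j ord_max 0 = 1. Proof. by rewrite mxE. Qed.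

Lemma gen_vectorS0 j : x j.+1 0 0 = r * (c * x j 0 0 - s * x j 1 0).
Proof.
by rewrite !gen_vector0 gen_vector1 -natr1 mulrDl mul1r cosD exprS; ring.
Qed.

Lemma gen_vectorS1 j : x j.+1 1 0 = r * (s * x j 0 0 + c * x j 1 0).
Proof.
by rewrite !gen_vector1 gen_vector0 -natr1 mulrDl mul1r sinD exprS; ring.
Qed.

Lemma A_theta_gen j : A_theta theta r *m x j = x j.+1.
Proof.
have e0 : (0 : 'I_3) = lshift 1 (0 : 'I_2) by apply: val_inj.
have e1 : (1 : 'I_3) = lshift 1 (1 : 'I_2) by apply: val_inj.
have e2 : (ord_max : 'I_3) = rshift 2 (0 : 'I_1) by apply: val_inj.
have E i : (A_theta theta r *m x j) i 0 = A_theta theta r i 0 * x j 0 0 +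
    A_theta theta r i 1 * x j 1 0 + A_theta theta r i ord_max * x j ord_max 0.
  rewrite mxE !big_ord_recl big_ord0 addr0 addrA.
  by congr (_ * _ + _ * _ + _ * _); congr (_ _ _); apply: val_inj.
apply/matrixP => i k; rewrite [k]ord1 E gen_vector2 mulr1.
have ul (a b : 'I_2) : A_theta theta r (lshift 1 a) (lshift 1 b) = r * rotation theta a b.
  by transitivity ((r *: rotation theta) a b); [exact: block_mxEul|rewrite mxE].
have ur (a : 'I_2) : A_theta theta r (lshift 1 a) (rshift 2 0) = 0.
  by transitivity ((0 : 'M[R]_(2, 1)) a 0); [exact: block_mxEur|rewrite mxE].
have dl (b : 'I_2) : A_theta theta r (rshift 2 0) (lshift 1 b) = 0.
  by transitivity ((0 : 'M[R]_(1, 2)) 0 b); [exact: block_mxEdl|rewrite mxE].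
have dr : A_theta theta r (rshift 2 0) (rshift 2 0) = 1.
  by transitivity ((1%:M : 'M[R]_1) 0 0); [exact: block_mxEdr|rewrite mxE].
have A00 : A_theta theta r 0 0 = r * rotation theta 0 0 by rewrite e0 ul.
have A01 : A_theta theta r 0 1 = r * rotation theta 0 1 by rewrite e0 e1 ul.
have A10 : A_theta theta r 1 0 = r * rotation theta 1 0 by rewrite e0 e1 ul.
have A11 : A_theta theta r 1 1 = r * rotation theta 1 1 by rewrite e1 ul.
have A02 : A_theta theta r 0 ord_max = 0 by rewrite e0 e2 ur.
have A12 : A_theta theta r 1 ord_max = 0 by rewrite e1 e2 ur.
have A20 : A_theta theta r ord_max 0 = 0 by rewrite e0 e2 dl.
have A21 : A_theta theta r ord_max 1 = 0 by rewrite e1 e2 dl.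
have A22 : A_theta theta r ord_max ord_max = 1 by rewrite e2 dr.
elim/ord3_ind: i.
- by rewrite gen_vectorS0 A00 A01 A02 addr0 !mxE /=; ring.
- by rewrite gen_vectorS1 A10 A11 A12 addr0 !mxE /=; ring.
- by rewrite gen_vector2 A20 A21 A22 !mul0r !add0r.
Qed.

(** [A_theta theta r] shifts the sequence by one and has determinant [r ^+ 2]. *)
Lemma det3_gen_shift i j k :
  det3 (x i.+1) (x j.+1) (x k.+1) = r ^+ 2 * det3 (x i) (x j) (x k).
Proof.
rewrite /det3 !gen_vectorS0 !gen_vectorS1 !gen_vector2.
have cs : c ^+ 2 + s ^+ 2 = 1 by rewrite cos2Dsin2.
rewrite -[r ^+ 2]mulr1 -cs; ring.
Qed.

Lemma det3_gen_shiftn n i j k :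
  det3 (x (n + i)) (x (n + j)) (x (n + k)) = r ^+ (2 * n) * det3 (x i) (x j) (x k).
Proof.
elim: n => [|n IH]; first by rewrite expr0 mul1r.
by rewrite !addSn det3_gen_shift IH mulrA -exprD mulnS.
Qed.

(* [|x_2 - x_1|^2] in the plane. *)
Definition step_norm : R := (r * c - 1) ^+ 2 + (r * s) ^+ 2.

Lemma gen_vector00 : x 0 0 0 = 1.
Proof. by rewrite gen_vector0 mul0r cos0 expr0 mulr1. Qed.

Lemma gen_vector01 : x 0 1 0 = 0.
Proof. by rewrite gen_vector1 mul0r sin0 mulr0. Qed.

(** Write [z = r e^(i theta)], so that [x l] is the point [z^l] at height 1. The determinant is
    [Im (conj (z - 1) (z^l - 1))], and its increment is [|z - 1|^2 Im (z^l)]. *)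
Lemma det3_gen01S l :
  det3 (x 0) (x 1) (x l.+1) = det3 (x 0) (x 1) (x l) + step_norm * x l 1 0.
Proof.
rewrite /det3 /step_norm !gen_vectorS0 !gen_vectorS1 !gen_vector2 gen_vector00 gen_vector01; ring.
Qed.

(** By the shift, the first term on the right is [det3 (x 1) (x l.+1) (x l.+2)]; replacing [x 1] by
    [x 0] costs [|z - 1|^2 Im (z^(l+1))]. *)
Lemma det3_gen0S l : det3 (x 0) (x l.+1) (x l.+2) =
  r ^+ 2 * det3 (x 0) (x l) (x l.+1) + step_norm * x l.+1 1 0.
Proof.
rewrite -det3_gen_shift /det3 /step_norm.
rewrite !(gen_vectorS0 l.+1) !(gen_vectorS1 l.+1).
rewrite !(gen_vectorS0 0) !(gen_vectorS1 0) !gen_vector2.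
rewrite gen_vector00 gen_vector01; ring.
Qed.

End Spiral.

(** * Signs of the sines and the positive root of [g_theta] *)

Section Root.
Context {R : realType}.
Variables (m : nat) (theta : R).
Hypotheses (m3 : (3 <= m)%N) (th1 : 2 * pi / m%:R < theta) (th2 : theta < 2 * pi / m.-1%:R).

Lemma theta_m : 2 * pi < m%:R * theta.
Proof using m3 th1 th2.
by have := th1; rewrite ltr_pdivrMr ?[theta * _]mulrC // ltr0n; lia.
Qed.

Lemma theta_m1 : m.-1%:R * theta < 2 * pi.
Proof using m3 th1 th2.
by have := th2; rewrite ltr_pdivlMr ?[theta * _]mulrC // ltr0n; lia.
Qed.

Lemma theta_gt0 : 0 < theta.
Proof using m3 th1 th2.
by apply: lt_trans th1; rewrite divr_gt0 ?mulr_gt0 ?pi_gt0 // ltr0n; lia.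
Qed.

Lemma natr_theta_le (i j : nat) : (i <= j)%N -> i%:R * theta <= j%:R * theta.
Proof using m3 th1 th2. by move=> ij; rewrite ler_pM2r ?theta_gt0 // ler_nat. Qed.

Lemma theta_lt_pi : theta < pi.
Proof using m3 th1 th2.
have := theta_m1; have := @natr_theta_le 2 m.-1 (ltac:(lia)); lra.
Qed.

Lemma sin_theta_gt0 : 0 < sin theta.
Proof using m3 th1 th2. by apply: sin_gt0_pi; rewrite theta_gt0 theta_lt_pi. Qed.

Lemma sin_lt0_2pi (y : R) : pi < y -> y < 2 * pi -> sin y < 0.
Proof.
move=> y1 y2; rewrite -(subrK pi y) sinDpi oppr_lt0; apply: sin_gt0_pi.
by rewrite subr_gt0 y1 ltrBlDr -mulr2n -mulr_natl.
Qed.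

Lemma mpredS : m%:R = m.-1%:R + 1 :> R.
Proof using m3. by rewrite natr1 prednK // (ltn_trans _ m3). Qed.

Lemma sin_m1_lt0 : sin (m.-1%:R * theta) < 0.
Proof using m3 th1 th2.
apply: sin_lt0_2pi theta_m1.
have := theta_m; rewrite mpredS; have := theta_lt_pi; lra.
Qed.

Lemma sin_m_gt0 : 0 < sin (m%:R * theta).
Proof using m3 th1 th2.
rewrite -(subrK (2 * pi) (m%:R * theta)) [2 * pi]mulr_natl sinD2pi; apply: sin_gt0_pi.
rewrite -mulr_natl; have := theta_m; rewrite mpredS.
by have := theta_m1; have := theta_lt_pi; move=> h1 h2 h3; apply/andP; split; lra.
Qed.

Lemma g_polyE (t : R) : (g_poly m theta).[t] =
  1 - (- sin (m.-1%:R * theta) / sin theta) * t ^+ m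
    - (sin (m%:R * theta) / sin theta) * t ^+ m.-1.
Proof. by rewrite /g_poly !hornerE; ring. Qed.

(** Both coefficients subtracted in [g_polyE] are positive, so the polynomial decreases strictly on
    [t >= 0] from the value 1. At [q = 1 + a^-1] it is nonpositive, since
    [a * q ^+ m >= a * q >= 1]. *)
Lemma g_poly_root : exists2 r : R, 0 < r & root (g_poly m theta) r /\
  forall t : R, 0 < t -> root (g_poly m theta) t -> t = r.
Proof using m3 th1 th2.
have m_gt0 : (0 < m)%N by lia.
have m1_gt0 : (0 < m.-1)%N by lia.
pose a := - sin (m.-1%:R * theta) / sin theta.
pose b := sin (m%:R * theta) / sin theta.
have a0 : 0 < a by rewrite divr_gt0 ?oppr_gt0 ?sin_m1_lt0 ?sin_theta_gt0.
have b0 : 0 < b by rewrite divr_gt0 ?sin_m_gt0 ?sin_theta_gt0.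
have gE t : (g_poly m theta).[t] = 1 - a * t ^+ m - b * t ^+ m.-1 by exact: g_polyE.
pose q := 1 + a^-1.
have q1 : 1 <= q by rewrite lerDl invr_ge0 ltW.
have q0 : 0 <= q by apply: le_trans q1.
have [|r /andP[r0 rq] rr] := @poly_ivt R (- g_poly m theta) 0 q q0.
  rewrite !hornerN oppr_le0 oppr_ge0 !gE !expr0n /=.
  have -> : (m == 0%N) = false by lia.
  have -> : (m.-1 == 0%N) = false by lia.
  rewrite !mulr0 !subr0 ler01 /=.
  have h : 1 <= a * q ^+ m.
    apply: (@le_trans _ _ (a * q)).
      by rewrite /q mulrDr mulr1 divff ?gt_eqF // lerDr ltW.
    rewrite ler_pM2l // -[leLHS]expr1; apply: ler_weXn2l => //; lia.
  have := mulr_ge0 (ltW b0) (exprn_ge0 m.-1 q0); lra.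
rewrite rootN in rr.
have r_gt0 : 0 < r.
  rewrite lt_def r0 andbT; apply: contraTneq rr => ->.
  rewrite /root gE !expr0n.
  have -> : (m == 0%N) = false by lia.
  have -> : (m.-1 == 0%N) = false by lia.
  by rewrite !mulr0 !subr0 oner_eq0.
have mono t u : 0 <= t -> t < u -> (g_poly m theta).[u] < (g_poly m theta).[t].
  move=> t0 tu; rewrite !gE.
  have h1 : a * t ^+ m < a * u ^+ m.
    by rewrite ltr_pM2l // ltrXn2r -?lt0n.
  have h2 : b * t ^+ m.-1 < b * u ^+ m.-1.
    by rewrite ltr_pM2l // ltrXn2r -?lt0n.
  lra.
exists r => //; split=> // t t0 /eqP tr; move/eqP: rr => rr.
have [tr'|rt|//] := ltgtP t r.
  by have := mono _ _ (ltW t0) tr'; rewrite tr rr ltxx.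
by have := mono _ _ r0 rt; rewrite tr rr ltxx.
Qed.

End Root.

(** * The cones K_theta *)

Lemma ord_split (m : nat) (i : 'I_m) : (i.+1 < m)%N \/ i.+1 = m.
Proof. by have := ltn_ord i; lia. Qed.

Section Polygon.
Context {R : realType}.
Variables (m : nat) (theta r : R).
Hypotheses (m3 : (3 <= m)%N) (th1 : 2 * pi / m%:R < theta) (th2 : theta < 2 * pi / m.-1%:R).
Hypotheses (r0 : 0 < r) (rg : root (g_poly m theta) r).
Local Notation x := (gen_vector theta r).
Local Notation K := (K_theta m theta r).

Lemma sin_pos (j : nat) : (0 < j)%N -> j%:R * theta < pi -> 0 < sin (j%:R * theta).
Proof.
move=> j0 jpi; apply: sin_gt0_pi; rewrite jpi andbT.
by rewrite mulr_gt0 ?ltr0n ?(theta_gt0 m3 th1 th2).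
Qed.

Lemma sin_neg (j : nat) : (j < m)%N -> pi <= j%:R * theta -> sin (j%:R * theta) <= 0.
Proof.
move=> jm; rewrite le_eqVlt => /orP[/eqP <-|jpi]; first by rewrite sinpi.
apply/ltW/sin_lt0_2pi => //; apply: le_lt_trans (theta_m1 m3 th1 th2).
by apply: (natr_theta_le m3 th1 th2); lia.
Qed.

Lemma step_norm_gt0 : 0 < step_norm theta r.
Proof.
apply: ltr_wpDl; first exact: sqr_ge0.
by rewrite exprn_gt0 // mulr_gt0 // (sin_theta_gt0 m3 th1 th2).
Qed.

(** With [last_b], the real solution of [z^m = last_a + last_b z] for [z = r e^(i theta)]. The value
    of [g_theta] at [r] is [1 - last_a - last_b], so at a root [z^m] lies on the line through [1]
    and [z]. *)
Definition last_a : R := - r ^+ m * sin (m.-1%:R * theta) / sin theta.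
Definition last_b : R := r ^+ m.-1 * sin (m%:R * theta) / sin theta.

Lemma last_a_gt0 : 0 < last_a.
Proof.
rewrite /last_a mulNr -mulrN divr_gt0 ?(sin_theta_gt0 m3 th1 th2) //.
by rewrite mulr_gt0 ?exprn_gt0 // oppr_gt0 (sin_m1_lt0 m3 th1 th2).
Qed.

Lemma last_b_gt0 : 0 < last_b.
Proof.
rewrite /last_b divr_gt0 ?(sin_theta_gt0 m3 th1 th2) //.
by rewrite mulr_gt0 ?exprn_gt0 // (sin_m_gt0 m3 th1 th2).
Qed.

Lemma gen_vector_last : x m = last_a *: x 0 + last_b *: x 1.
Proof.
have s0 : sin theta != 0 by rewrite lt0r_neq0 // (sin_theta_gt0 m3 th1 th2).
have rm : r ^+ m = r * r ^+ m.-1 by rewrite -exprS prednK //; lia.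
have sm : sin (m.-1%:R * theta) =
    sin (m%:R * theta) * cos theta - cos (m%:R * theta) * sin theta.
  by rewrite -sinB; congr sin; rewrite (mpredS m3); ring.
apply/matrixP => i k; rewrite [k]ord1 [RHS]mxE [X in X + _]mxE [X in _ + X]mxE.
elim/ord3_ind: i.
- rewrite gen_vectorS0 gen_vector00 gen_vector01 gen_vector0 /last_a /last_b sm rm.
  by field; exact: s0.
- rewrite gen_vectorS1 gen_vector00 gen_vector01 gen_vector1 /last_a /last_b rm.
  by field; exact: s0.
- rewrite !gen_vector2 !mulr1 /last_a /last_b.
  have := rg; rewrite /root g_polyE => /eqP h; apply/eqP; rewrite eq_sym -subr_eq0.
  by rewrite -oppr_eq0 -h; apply/eqP; field; exact: s0.
Qed.

Lemma det3_01_last : det3 (x 0) (x 1) (x m) = 0.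
Proof. by rewrite gen_vector_last det3D !det3Z det3xyx det3xyy !mulr0 addr0. Qed.

Lemma det3_01_first : det3 (x 0) (x 1) (x 1) = 0. Proof. exact: det3xyy. Qed.

(* The increments [sin (l theta)] change sign once, and both ends vanish. *)
Lemma det3_01_gt0 (l : nat) : (1 < l < m)%N -> 0 < det3 (x 0) (x 1) (x l).
Proof.
have kap := step_norm_gt0.
have th0 := theta_gt0 m3 th1 th2.
have up k : k.+1%:R * theta < pi -> 0 < det3 (x 0) (x 1) (x k.+2).
  elim: k => [|k IH] kpi; rewrite det3_gen01S.
    rewrite det3_01_first add0r mulr_gt0 // gen_vector1 mulr_gt0 ?exprn_gt0 //.
    exact: sin_pos.
  apply: addr_gt0; first by apply: IH; apply: le_lt_trans kpi; apply: (natr_theta_le m3 th1 th2).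
  by rewrite mulr_gt0 // gen_vector1 mulr_gt0 ?exprn_gt0 // sin_pos.
have down k l' : (l' + k.+1 = m)%N -> pi < l'%:R * theta -> 0 < det3 (x 0) (x 1) (x l').
  elim: k l' => [|k IH] l' lk lpi.
    have lm : (l' < m)%N by rewrite -lk addn1.
    have lS : l'.+1 = m by rewrite -lk addn1.
    have := det3_gen01S theta r l'; rewrite lS det3_01_last => /eqP.
    rewrite eq_sym addr_eq0 => /eqP ->; rewrite -mulrN mulr_gt0 //.
    rewrite gen_vector1 -mulrN mulr_gt0 ?exprn_gt0 // oppr_gt0.
    apply: sin_lt0_2pi => //; apply: le_lt_trans (theta_m1 m3 th1 th2).
    by apply: (natr_theta_le m3 th1 th2); rewrite -lk addn1.
  have lm : (l' < m)%N by rewrite -lk -addSnnS leq_addr.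
  have := IH l'.+1 _ _; rewrite addSnnS => /(_ lk) /(_ _).
  rewrite det3_gen01S => h; have {}h := h (lt_le_trans lpi (natr_theta_le m3 th1 th2 (leqnSn _))).
  have : step_norm theta r * x l' 1 0 <= 0.
    rewrite pmulr_rle0 // gen_vector1 pmulr_rle0 ?exprn_gt0 //.
    by apply: sin_neg => //; apply: ltW.
  move=> h'; apply: lt_le_trans h _; by rewrite gerDl.
move=> /andP[l1 lm].
have [lpi|lpi] := ltP (l.-1%:R * theta) pi.
  case: l l1 lm lpi => [|[|l]] //= l1 lm lpi; exact: up.
apply: (down (m - l).-1) => //; first by lia.
apply: le_lt_trans lpi _; rewrite ltr_pM2r // ltr_nat; lia.
Qed.

(** Upwards from [det3 (x 0) (x 0) (x 1) = 0] while the sines are positive, downwards from the last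
    triangle afterwards. That triangle, shifted once, equals [last_a] times
    [det3 (x 0) (x 1) (x m.-1)]. *)
Lemma det3_0S_gt0 (l : nat) : (0 < l)%N -> (l.+1 < m)%N -> 0 < det3 (x 0) (x l) (x l.+1).
Proof.
have kap := step_norm_gt0.
have th0 := theta_gt0 m3 th1 th2.
have r2 : 0 < r ^+ 2 by apply: exprn_gt0.
have up k : k.+1%:R * theta < pi -> 0 < det3 (x 0) (x k.+1) (x k.+2).
  elim: k => [|k IH] kpi; rewrite det3_gen0S.
    rewrite det3xx mulr0 add0r mulr_gt0 // gen_vector1 mulr_gt0 ?exprn_gt0 //.
    exact: sin_pos.
  apply: addr_gt0.
    by rewrite mulr_gt0 //; apply: IH; apply: le_lt_trans kpi; apply: (natr_theta_le m3 th1 th2).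
  by rewrite mulr_gt0 // gen_vector1 mulr_gt0 ?exprn_gt0 // sin_pos.
have last : 0 < det3 (x 0) (x m.-2) (x m.-1).
  rewrite -(pmulr_rgt0 _ r2) -det3_gen_shift.
  have -> : m.-2.+1 = m.-1 by lia.
  have -> : m.-1.+1 = m by lia.
  rewrite gen_vector_last det3D !det3Z det3xyx mulr0 addr0 -det3_rot.
  by rewrite mulr_gt0 ?last_a_gt0 // det3_01_gt0 //; lia.
have down k l' : (l' + k.+2 = m)%N -> pi <= l'.+1%:R * theta -> 0 < det3 (x 0) (x l') (x l'.+1).
  elim: k l' => [|k IH] l' lk lpi.
    by move: last; rewrite -lk addn2.
  have lm : (l'.+1 < m)%N by rewrite -lk !addnS !ltnS leqW // leq_addr.
  have := IH l'.+1 _ _; rewrite addSnnS => /(_ lk) /(_ _).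
  rewrite det3_gen0S => h; have {}h := h (le_trans lpi (natr_theta_le m3 th1 th2 (leqnSn _))).
  have h' : step_norm theta r * x l'.+1 1 0 <= 0.
    rewrite pmulr_rle0 // gen_vector1 pmulr_rle0 ?exprn_gt0 //.
    exact: sin_neg.
  rewrite -(pmulr_rgt0 _ r2); apply: lt_le_trans h _; by rewrite gerDl.
move=> l1 lm.
have [lpi|lpi] := ltP (l%:R * theta) pi.
  by case: l l1 lm lpi => [|l] //= l1 lm lpi; apply: up.
apply: (down (m - l).-2) => //; first by lia.
apply: le_trans lpi _; exact: (natr_theta_le m3 th1 th2).
Qed.

Definition nx (i : nat) : nat := if i.+1 == m then 0%N else i.+1.
Definition pv (i : nat) : nat := if i == 0%N then m.-1 else i.-1.
Definition edge (i : nat) (w : 'cV[R]_3) : R := det3 (x i) (x (nx i)) w.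

(** Shifting the smallest index to 0 reduces to [det3_01_gt0] when [k] follows the edge and to
    [det3_0S_gt0] when it precedes it. The closing edge is shifted forward instead, with [x m]
    expanded on [x 0], [x 1]. *)
Lemma edge_gt0 (i k : nat) : (i < m)%N -> (k < m)%N -> k != i -> k != nx i ->
  0 < edge i (x k).
Proof.
have r2 : 0 < r ^+ 2 by apply: exprn_gt0.
move=> im km ki; rewrite /edge /nx; case: (i.+1 =P m) => iL kn.
  have E : r ^+ 2 * det3 (x i) (x 0) (x k) = last_a * det3 (x 0) (x 1) (x k.+1).
    rewrite -det3_gen_shift iL gen_vector_last det3_rot det3D !det3Z.
    by rewrite det3xyx mulr0 addr0 -det3_rot.
  by rewrite -(pmulr_rgt0 _ r2) E mulr_gt0 ?last_a_gt0 // det3_01_gt0 //; lia.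
have [ik|ki'] := ltnP i k.
  have := det3_gen_shiftn theta r i 0 1 (k - i).
  rewrite addn0 addn1 subnKC ?(ltnW ik) // => ->.
  by rewrite mulr_gt0 ?exprn_gt0 // det3_01_gt0 //; lia.
have := det3_gen_shiftn theta r k 0 (i - k) (i - k).+1.
rewrite addn0 addnS subnKC // => E; rewrite -det3_rot E.
by rewrite mulr_gt0 ?exprn_gt0 // det3_0S_gt0 //; lia.
Qed.

Lemma edge_self i : edge i (x i) = 0. Proof. exact: det3xyx. Qed.

Lemma edge_nx i : edge i (x (nx i)) = 0. Proof. exact: det3xyy. Qed.

Lemma edge_ge0 (i k : nat) : (i < m)%N -> (k < m)%N -> 0 <= edge i (x k).
Proof.
move=> im km; have [->|ki] := eqVneq k i; first by rewrite edge_self.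
have [->|kn] := eqVneq k (nx i); first by rewrite edge_nx.
exact/ltW/edge_gt0.
Qed.

Lemma edgeD i u w : edge i (u + w) = edge i u + edge i w. Proof. exact: det3D. Qed.

Lemma edgeZ i (t : R) u : edge i (t *: u) = t * edge i u. Proof. exact: det3Z. Qed.

Lemma K_theta_convex : convex_cone K.
Proof.
split=> [|_ _ [c c0 ->] [d d0 ->]|t _ t0 [c c0 ->]].
- by exists (fun=> 0) => //; rewrite big1 // => i _; exact: scale0r.
- exists (fun i => c i + d i) => [i|]; first exact: addr_ge0.
  by rewrite -big_split /=; apply: eq_bigr => i _; rewrite scalerDl.
- exists (fun i => t * c i) => [i|]; first exact: mulr_ge0.
  by rewrite scaler_sumr; apply: eq_bigr => i _; rewrite scalerA.
Qed.

Lemma K_theta_gen (i : nat) : (i < m)%N -> K (x i).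
Proof.
move=> im; exists (fun j : 'I_m => if j == Ordinal im then 1 else 0).
  by move=> j; case: ifP.
rewrite (bigD1 (Ordinal im)) //= eqxx scale1r big1 ?addr0 // => j /negPf ->.
exact: scale0r.
Qed.

(** The converse uses the fan of triangles with apex [x 0]: for the least [j > 1] with [h j <= 0],
    the vector lies in the cone of [x 0], [x j.-1], [x j], and its Cramer coefficients are
    nonnegative. *)
Lemma K_theta_edge (w : 'cV[R]_3) : K w <-> forall i, (i < m)%N -> 0 <= edge i w.
Proof.
have m_gt0 : (0 < m)%N by lia.
have nxL : nx m.-1 = 0%N by rewrite /nx prednK ?eqxx.
have nxS i : (i.+1 < m)%N -> nx i = i.+1.
  by rewrite /nx => im; case: eqP => // iE; rewrite iE ltnn in im.
split=> [[c c0 ->] i im|H].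
  elim/big_ind: _ => [|u v|j _].
  - by rewrite -(scale0r (x 0)) edgeZ mul0r.
  - by rewrite edgeD; apply: addr_ge0.
  - by rewrite edgeZ mulr_ge0 // edge_ge0.
pose h j := det3 (x 0) (x j) w.
have h1 : 0 <= h 1%N by have := H 0%N m_gt0; rewrite /edge nxS //; lia.
have hL : h m.-1 <= 0.
  have := H m.-1; rewrite /edge nxL det3_swap oppr_ge0; apply; lia.
have exP : exists j, (1 < j)%N && (h j <= 0) by exists m.-1; rewrite hL andbT; lia.
case: (ex_minnP exP) => j /andP[j1 hj] jmin.
have jm : (j < m)%N.
  by have := jmin m.-1; rewrite hL andbT => /(_ (ltac:(lia))); lia.
have hi : 0 <= h j.-1.
  have [j2|j2] := leqP j 2; first by have -> : j.-1 = 1%N by lia.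
  rewrite leNgt; apply/negP => hneg; have := jmin j.-1.
  rewrite (ltW hneg) andbT => /(_ (ltac:(lia))); lia.
have jS : j.-1.+1 = j by lia.
have jS' : (j.-1.+1 < m)%N by rewrite jS.
have j0' : (0 < j.-1)%N by lia.
have D : 0 < det3 (x 0) (x j.-1) (x j) by have := det3_0S_gt0 j0' jS'; rewrite jS.
have e1 : 0 <= det3 w (x j.-1) (x j).
  by have := H j.-1 (ltnW jS'); rewrite /edge nxS // jS -det3_rot.
have e2 : 0 <= det3 (x 0) w (x j) by rewrite -det3_rot det3_swap -det3_rot oppr_ge0 det3_rot.
have Kc := K_theta_convex.
have jm1 : (j.-1 < m)%N := ltnW jS'.
have -> : w = (det3 (x 0) (x j.-1) (x j))^-1 *: (det3 (x 0) (x j.-1) (x j) *: w).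
  by rewrite scalerA mulVf ?scale1r // lt0r_neq0.
rewrite cramer3; apply: coneZ => //; first by rewrite invr_ge0 ltW.
by do 2?[apply: coneD => //]; apply: coneZ => //; apply: K_theta_gen.
Qed.

Lemma K_theta_coord2 (w : 'cV[R]_3) : K w -> 0 <= w ord_max 0.
Proof.
move=> [c c0 ->]; rewrite summxE sumr_ge0 // => i _.
by rewrite mxE gen_vector2 mulr1.
Qed.

Lemma continuous_det3 (u v : 'cV[R]_3) : continuous (det3 u v : 'cV[R]_3 -> R).
Proof.
move=> w.
have co (i : 'I_3) : (fun M : 'cV[R]_3 => M i 0) @ w --> w i 0 by exact: coord_continuous.
have E : det3 u v = (fun M : 'cV[R]_3 =>
    (u 1 0 * v ord_max 0 - u ord_max 0 * v 1 0) * M 0 0 +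
    (u ord_max 0 * v 0 0 - u 0 0 * v ord_max 0) * M 1 0 +
    (u 0 0 * v 1 0 - u 1 0 * v 0 0) * M ord_max 0).
  by apply/funext => M; rewrite /det3; ring.
rewrite E; exact: (cvgD (cvgD (cvgM (cvg_cst _) (co 0)) (cvgM (cvg_cst _) (co 1)))
  (cvgM (cvg_cst _) (co ord_max))).
Qed.

Lemma K_theta_proper : proper_cone K.
Proof.
have m_gt0 : (0 < m)%N by lia.
split; first exact: K_theta_convex.
- have -> : K = \bigcap_(i in [set i | (i < m)%N]) (edge i @^-1` [set t | 0 <= t]).
    by apply/seteqP; split=> [w /K_theta_edge|w H]; [|apply/K_theta_edge].
  apply: closed_bigI => i _; apply: preimage_closed; last exact: closed_ge.
  by move=> w _; apply: continuous_det3.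
- apply/seteqP; split=> [w [Kw [u Ku wE]]|w ->]; last first.
    have K0 := cone0 K_theta_convex.
    by split=> //; exists 0; rewrite ?oppr0.
  move: Kw => [c c0 wE']; have := K_theta_coord2 Ku.
  have -> : u ord_max 0 = - w ord_max 0 by rewrite -wE mxE opprK.
  have w2 : w ord_max 0 = \sum_i c i.
    by rewrite wE' summxE; apply: eq_bigr => i _; rewrite mxE gen_vector2 mulr1.
  rewrite oppr_ge0 w2 => cs.
  have /eqP : \sum_i c i = 0 by apply/le_anti; rewrite cs sumr_ge0.
  rewrite psumr_eq0 // => /allP cz.
  rewrite /= wE' big1 // => i _; have := cz i (mem_index_enum _) => /eqP ->.
  exact: scale0r.
(* Each [edge i] vanishes at only two generators, so it is positive at one of these three. *)
- exists (x 0 + x 1 + x 2).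
  have near_pos : \forall w \near (x 0 + x 1 + x 2 : 'cV[R]_3), forall i : 'I_m, 0 < edge i w.
    apply: (@filter_forall _ _ (fun i : 'I_m => [set w | 0 < edge i w]) (nbhs _) _) => i.
    have pos : 0 < edge i (x 0 + x 1 + x 2).
      have m1 : (1 < m)%N by lia.
      have m2 : (2 < m)%N by lia.
      have im := ltn_ord i.
      have := edge_ge0 im m_gt0; have := edge_ge0 im m1; have := edge_ge0 im m2.
      have : [|| 0 < edge i (x 0), 0 < edge i (x 1) | 0 < edge i (x 2)].
        have [i0|i0] := posnP i; last have [i1|i1] := eqVneq (i : nat) 1%N.
        - by rewrite [X in [|| _, _ | X]]edge_gt0 ?orbT // /nx i0 //; case: ifP.
        - by rewrite [X in [|| X, _ | _]]edge_gt0 // /nx i1 //; case: ifP => //; lia.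
        - rewrite [X in [|| _, X | _]]edge_gt0 ?orbT // /nx; first by rewrite eq_sym.
          by case: ifP => // _; lia.
      rewrite !edgeD; move: (edge i (x 0)) (edge i (x 1)) (edge i (x 2)) => p q t.
      by case/or3P; lra.
    exact: (@cvgr_gt R _ (nbhs (x 0 + x 1 + x 2)) _ (edge i) _
      (@continuous_det3 (x i) (x (nx i)) _) 0 pos).
  apply: filterS near_pos => w H; apply/K_theta_edge => i im.
  exact: ltW (H (Ordinal im)).
Qed.


Let Kp := K_theta_proper.
Let Kc := K_theta_convex.

Lemma pv_lt (i : nat) : (i < m)%N -> (pv i < m)%N.
Proof. by rewrite /pv; case: eqP => _ im; lia. Qed.

Lemma nx_lt (i : nat) : (i < m)%N -> (nx i < m)%N.
Proof. by rewrite /nx; case: eqP => ii im; lia. Qed.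

Lemma nx_pv (i : nat) : (i < m)%N -> nx (pv i) = i.
Proof.
by rewrite /nx /pv; case: (i =P 0%N) => i0 im; case: eqP; lia.
Qed.

Lemma pv_neq (i : nat) : (i < m)%N -> pv i != i /\ nx i != i /\ nx i != pv i.
Proof.
rewrite /nx /pv => im.
by case: (i.+1 =P m) => h; case: (i =P 0%N) => h'; repeat split; lia.
Qed.

Lemma gen_vector_neq0 i : x i != 0.
Proof.
by apply/eqP => /matrixP/(_ ord_max 0)/eqP; rewrite gen_vector2 mxE oner_eq0.
Qed.

(** [x i] lies on two edges, whose functionals are nonnegative on [K] and hence vanish on everything
    in [K] dominated by [x i]. Cramer's rule then leaves a multiple of [x i], whose sign is read off
    the third coordinate. *)
Lemma gen_vector_dom (i : nat) (u : 'cV[R]_3) : (i < m)%N -> K u -> dom K (x i) u ->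
  exists2 c : R, 0 <= c & u = c *: x i.
Proof.
move=> im Ku [c c0 Kcu].
have ev k : (k < m)%N -> edge k (x i) = 0 -> edge k u = 0.
  move=> km ki; have /K_theta_edge/(_ k km) := Kcu.
  rewrite -scaleN1r edgeD !edgeZ ki mulr0 add0r mulN1r oppr_ge0 => h.
  by apply/le_anti; rewrite h; have /K_theta_edge -> := Ku.
have [n1 [n2 n3]] := pv_neq im.
have pm := pv_lt im.
have e1 : det3 u (x i) (x (nx i)) = 0.
  by rewrite det3_rot; apply: ev => //; apply: edge_self.
have e2 : det3 (x (pv i)) (x i) u = 0.
  by have := ev (pv i) pm; rewrite -{2}(nx_pv im) edge_nx /edge nx_pv // => /(_ erefl).
have D : 0 < det3 (x (pv i)) (x i) (x (nx i)).
  by have := edge_gt0 pm (nx_lt im) n3; rewrite /edge nx_pv //; apply.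
have uE : u = (det3 (x (pv i)) u (x (nx i)) / det3 (x (pv i)) (x i) (x (nx i))) *: x i.
  apply: (scalerI (lt0r_neq0 D)); rewrite cramer3 e1 e2 !scale0r add0r addr0.
  by rewrite scalerA [_ * (_ / _)]mulrC divfK // lt0r_neq0.
exists (det3 (x (pv i)) u (x (nx i)) / det3 (x (pv i)) (x i) (x (nx i))) => //.
have := K_theta_coord2 Ku; rewrite {1}uE mxE gen_vector2 mulr1.
exact.
Qed.

Lemma gen_vector_inj (i j : nat) : (i < m)%N -> (j < m)%N -> x i = x j -> i = j.
Proof.
move=> im jm E; apply/eqP; apply: contraT => ij.
have ji : j != i by rewrite eq_sym.
have [jn|jn] := eqVneq j (nx i); last first.
  by have := edge_gt0 im jm ji jn; rewrite -E edge_self ltxx.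
have [jn'|jn'] := eqVneq i (nx j); last first.
  by have := edge_gt0 jm im ij jn'; rewrite E edge_self ltxx.
by move: ij jn jn'; rewrite /nx; case: (i.+1 =P m); case: (j.+1 =P m); lia.
Qed.

Lemma K_theta_rays : ray_system K (fun i : 'I_m => x i).
Proof.
have Kx (i : 'I_m) : K (x i) by apply: K_theta_gen.
split=> [i|w /(extreme_vectorP Kc)[Kw w0 wext]|i j /(gen_vector_dom (ltn_ord i) (Kx j))[c _ E]].
- apply/(extreme_vectorP Kc); split=> //; first exact: gen_vector_neq0.
  by move=> u Ku; apply: gen_vector_dom.
- have [c c0 wE] := Kw.
  have [i ci] : exists i, c i != 0.
    apply: contrapT => N; case/eqP: w0; rewrite wE big1 // => i _.
    have [->|ci] := eqVneq (c i) 0; first exact: scale0r.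
    by case: N; exists i.
  have cp : 0 < c i by rewrite lt_def ci c0.
  have wi : dom K w (x i).
    rewrite wE (bigD1 i) //=; apply: (@dom_trans _ _ _ Kc (c i *: x i)).
      apply: dom_addl; elim/big_ind: _ => [|u v|j _]; first exact: cone0.
        exact: coneD.
      by apply: coneZ.
    exact: dom_pscale.
  have [d d0 E] := wext _ (Kx i) wi.
  have dn : d != 0.
    by apply: contra_neq (gen_vector_neq0 i) => d00; rewrite E d00 scale0r.
  exists i, d^-1; split; first by rewrite invr_gt0 lt_def dn.
  by rewrite E scalerA mulVf // scale1r.
- have := congr1 (fun M : 'cV[R]_3 => M ord_max 0) E.
  rewrite /= gen_vector2 [RHS]mxE gen_vector2 mulr1 => c1.
  move: E; rewrite -c1 scale1r => E; apply: val_inj.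
  exact: (gen_vector_inj (ltn_ord i) (ltn_ord j) (esym E)).
Qed.

Lemma A_theta_preserving : cone_preserving K (A_theta theta r).
Proof.
have m_gt0 : (0 < m)%N by lia.
have m_gt1 : (1 < m)%N by lia.
move=> w [c c0 ->]; rewrite mulmx_sumr.
elim/big_ind: _ => [|u v|i _]; [exact: cone0|exact: coneD|].
rewrite -scalemxAr A_theta_gen; apply: coneZ => //.
have [im|im] := ord_split i; first exact: K_theta_gen.
rewrite im gen_vector_last; apply: coneD => //; apply: coneZ => //.
- exact/ltW/last_a_gt0.
- exact: K_theta_gen.
- exact/ltW/last_b_gt0.
- exact: K_theta_gen.
Qed.

Lemma A_theta_F1 : F1_rays K (fun i : 'I_m => x i) (A_theta theta r).
Proof.
have m_gt0 : (0 < m)%N by lia.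
have m_gt1 : (1 < m)%N by lia.
have vr := K_theta_rays.
have nx0 : nx 0 = 1%N by rewrite /nx; case: eqP => //; lia.
have Kx (i : nat) : (i < m)%N -> K (x i) by apply: K_theta_gen.
split=> // i j; rewrite A_theta_gen /F1.
have [im|im] := ord_split i.
  have -> : (i.+1 == m) = false by rewrite ltn_eqF.
  rewrite orbF; split=> [d|/eqP ->]; last exact: dom_refl.
  by rewrite -(@ray_inj _ _ _ _ vr (Ordinal im) j d).
rewrite im eqxx (ltn_eqF (ltn_ord j)) /=; split=> [|/orP[]/eqP ->].
(* [edge 0] vanishes at [x m] and is positive at every generator except [x 0] and [x 1], so no other
   ray is dominated. *)
- move=> [c _ /K_theta_edge/(_ 0%N m_gt0)].
  rewrite -scaleN1r edgeD !edgeZ {1}/edge nx0 det3_01_last mulr0 add0r mulN1r.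
  rewrite oppr_ge0 => h; apply/orP.
  have [j0|j0] := eqVneq (j : nat) 0%N; first by left.
  have [j1|j1] := eqVneq (j : nat) 1%N; first by right.
  by have := @edge_gt0 0 j m_gt0 (ltn_ord j) j0; rewrite nx0 => /(_ j1); rewrite ltNge h.
- rewrite gen_vector_last; apply: (@dom_trans _ _ _ Kc (last_a *: x 0)).
    by apply: dom_addl; apply: coneZ => //; [exact/ltW/last_b_gt0|exact: Kx].
  by apply: dom_pscale => //; apply: last_a_gt0.
- rewrite gen_vector_last; apply: (@dom_trans _ _ _ Kc (last_b *: x 1)).
    by apply: dom_addr; apply: coneZ => //; [exact/ltW/last_a_gt0|exact: Kx].
  by apply: dom_pscale => //; apply: last_b_gt0.
Qed.

Lemma A_theta_primitive : primitive K (A_theta theta r).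
Proof. exact: (F1_primitive Kp m3 A_theta_F1 A_theta_preserving). Qed.

End Polygon.

Lemma max_cone_exponent_eq (R : realType) (m : nat) : (3 <= m)%N ->
  max_cone_exponent R m 3 (2 * m - 1).
Proof.
move=> m3.
have bound (K : set 'cV[R]_3) q : polycone m K -> cone_exponent K q -> (q <= 2 * m - 1)%N.
  by move=> Kpoly; have [Kp _] := Kpoly; have [v vr] := (polycone_ray_system m3 Kp).1 Kpoly;
    apply: (cone_exponent_leq m3 Kp vr).
split=> [K Kpoly|].
  have [Kp _] := Kpoly; have [v vr] := (polycone_ray_system m3 Kp).1 Kpoly.
  exact: (exists_cone_exponent m3 Kp vr).
split; last by move=> q [K Kpoly]; apply: bound.
have m1 : (0 : R) < m.-1%:R by rewrite ltr0n; lia.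
have th : 2 * pi / m%:R < 2 * pi / m.-1%:R :> R.
  rewrite ltr_pM2l ?mulr_gt0 ?pi_gt0 // ltf_pV2 ?posrE ?ltr0n ?ltr_nat; lia.
(* Any angle in the open interval serves to show that the bound is attained; the midpoint is
   taken. *)
pose theta : R := (2 * pi / m%:R + 2 * pi / m.-1%:R) / 2.
have th1 : 2 * pi / m%:R < theta by rewrite /theta; lra.
have th2 : theta < 2 * pi / m.-1%:R by rewrite /theta; lra.
have [r r0 [rg _]] := g_poly_root m3 th1 th2.
have Kp := K_theta_proper m3 th1 th2 r0 rg.
have vF := A_theta_F1 m3 th1 th2 r0 rg.
exists (K_theta m theta r).
  by apply/(polycone_ray_system m3 Kp); exists (fun i : 'I_m => gen_vector theta r i); case: vF.
apply: (F1_cone_exponent m3 Kp vF).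
exact: (A_theta_primitive m3 th1 th2 r0 rg).
Qed.

Theorem theorem6p4 (R : realType) :
  [/\ forall m : nat, (3 <= m)%N -> max_cone_exponent R m 3 (2 * m - 1)%N,
      forall (m : nat) (K : set 'cV[R]_3), (3 <= m)%N -> polycone m K ->
        (exp_maximal_cone m K <->
         exists2 A : 'M[R]_3, primitive K A
           & digraph_iso (extreme_rays K) (ray_arc K A)
                         [set: 'I_m] (fun i j => F1 i j))
    & forall (m : nat) (theta : R), (3 <= m)%N ->
        2 * pi / m%:R < theta -> theta < 2 * pi / m.-1%:R ->
        exists r : R,
          [/\ 0 < r, root (g_poly m theta) r,
              forall s : R, 0 < s -> root (g_poly m theta) s -> s = r
            & [/\ forall v : 'cV[R]_3,
                    extreme_vector (K_theta m theta r) v <->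
                    exists (j : 'I_m) (c : R),
                      0 < c /\ v = c *: gen_vector theta r j,
                  exp_maximal_cone m (K_theta m theta r)
                & exp_maximal_matrix (K_theta m theta r) (A_theta theta r)]]].
Proof.
split=> [m m3|m K m3 Kpoly|m theta m3 th1 th2]; first exact: max_cone_exponent_eq.
  have [Kp _] := Kpoly; have [v vr] := (polycone_ray_system m3 Kp).1 Kpoly.
  split=> [[_ [p Kexp [_ pmax]]]|[A Apr]].
    have [_ mmax] := max_cone_exponent_eq R m3.
    rewrite (is_max_unique pmax mmax) in Kexp.
    have [[A Apr Aexp] _] := Kexp; exists A => //.
    have KA : cone_preserving K A by case: Apr.
    by apply/(digraph_iso_F1 m3 Kp KA); apply: (exponent_extremal m3 Kp vr Apr Aexp).
  have KA : cone_preserving K A by case: Apr.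
  move=> /(digraph_iso_F1 m3 Kp KA)[w wF]; split=> //.
  exists (2 * m - 1)%N; last exact: max_cone_exponent_eq.
  exact: (F1_cone_exponent m3 Kp wF Apr).
have [r r0 [rg runiq]] := g_poly_root m3 th1 th2.
exists r; split=> //.
have Kp := K_theta_proper m3 th1 th2 r0 rg.
have Kc := proper_convex Kp.
have vF := A_theta_F1 m3 th1 th2 r0 rg.
have Apr := A_theta_primitive m3 th1 th2 r0 rg.
have vr : ray_system (K_theta m theta r) (fun i : 'I_m => gen_vector theta r i) by case: vF.
have Kexp := F1_cone_exponent m3 Kp vF Apr.
split.
- move=> v; split=> [vext|[j [c [c0 ->]]]]; first by case: vr => _ /(_ v vext).
  have Kx := ray_in vr j.
  apply/(extreme_vectorP Kc); split.
  + by apply: coneZ => //; apply: ltW.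
  + by rewrite scaler_eq0 gt_eqF //= (ray_neq0 vr j).
  move=> u Ku cu; have [|d d0 ->] := ray_dom Kp vr (i := j) Ku.
    apply: (dom_trans Kc _ cu); apply: domZ_ge0 (ltW c0) _ => //; exact: dom_refl.
  exists (d / c); first by rewrite divr_ge0 // ltW.
  by rewrite scalerA divfK // gt_eqF.
- split; first by apply/(polycone_ray_system m3 Kp); exists (fun i : 'I_m => gen_vector theta r i).
  by exists (2 * m - 1)%N => //; apply: max_cone_exponent_eq.
- split=> //; exists (2 * m - 1)%N => //.
  exact: (exponent_F1 m3 Kp vr Apr vF).
Qed.
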